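(* There is a universal constant $\alpha\in\mathbb{N}$ such that the following holds. Given integers $N,a,b$ with $b\le a$, there is a deterministic algorithm $\mathcal{A}$ computing an $(N,a,b,\ell)_2$-Hit and Miss hash family where \[ \ell\le \begin{cases} (\alpha c ab)^{b+1}, & \text{if } a\ge N^{1/c} \text{ for some constant } c\in\mathbb{N},\\ (\alpha ab)^{b+2}\cdot\log N, & \text{if } a=N^{o(1)} \text{ and } b=\Omega(\log N),\\ (\alpha ab)^{b+2}\cdot\log N, & \text{if } a\le\log N,\\ (\alpha ab\log N)^{b+1}, & \text{otherwise.} \end{cases} \] Moreover, the running time of $\mathcal{A}$ is $N^{1+o(1)}\cdot\ell$ if $a=N^{o(1)}$ and $b=\Omega(\log N)$, and $N\cdot(\log N)^{O(1)}\cdot\ell$ otherwise.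
   Context: For $N,a,b,\ell,q\in\mathbb{N}$ with $b\le a$, a family $\mathcal{H}=\{h_i:[N]\to[q]\mid i\in[\ell]\}$ is an $(N,a,b,\ell)_q$-Hit and Miss (HM) hash family if for every pair of disjoint subsets $A,B\subseteq[N]$ with $|A|\le a$ and $|B|\le b$ there exists $i\in[\ell]$ such that $h_i(x)\neq h_i(y)$ for all $(x,y)\in A\times B$. Computing the family means outputting the $\ell\times N$ matrix whose $(i,x)$ entry is $h_i(x)$. *)

(* Defs.v *)
From HB Require Import structures.
From mathcomp Require Import all_boot all_order all_algebra.
From mathcomp Require Import all_classical all_reals all_analysis.

Set Implicit Arguments.
Unset Strict Implicit.
Unset Printing Implicit Defensive.

Import Order.TTheory GRing.Theory Num.Theory.
Import numFieldNormedType.Exports.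

Local Open Scope nat_scope.

(* [N] and [q] are rendered as 'I_N and 'I_q, and the index set [l] as 'I_l. *)
Definition HM_family (N a b l q : nat) (h : 'I_l -> 'I_N -> 'I_q) : Prop :=
  forall A B : {set 'I_N},
    [disjoint A & B] -> #|A| <= a -> #|B| <= b ->
    exists i : 'I_l,
      forall x y : 'I_N, x \in A -> y \in B -> h i x != h i y.

(* The l x N matrix (h i x), listed row by row. *)
Definition matrix_listing (N l q : nat) (h : 'I_l -> 'I_N -> 'I_q) : seq nat :=
  [seq (h i x : nat) | i <- enum 'I_l, x <- enum 'I_N].

(** * Deterministic word RAM

    Programs are structured: registers indexed by nat, finitely many arrays
    (the array name is a constant of the program, the index is a computed
    word), and a write-only output tape.  A program is run with words in
    {0, ..., W - 1}; addition and multiplication are modulo W, subtraction is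
    truncated at 0, and division by 0 follows %/ and %%.  Each arithmetic
    operation, register access, array access, branching test and output of a
    word costs one unit.

    The output goes to a tape rather than to memory because the number of
    entries of the matrix is not polynomially bounded in N, so that they
    cannot all be addressed by words of O(log N) bits. *)

Inductive binop := OpAdd | OpSub | OpMul | OpDiv | OpMod | OpEq | OpLt.

Inductive expr :=
  | Cst of nat
  | Reg of nat
  | Arr of nat & expr
  | Bin of binop & expr & expr.

Inductive cmd :=
  | Skip
  | Assign of nat & expr           (* register := expression *)
  | Store of nat & expr & expr     (* array[index] := expression *)
  | Emit of expr                   (* append a word to the output *)
  | Seq of cmd & cmd
  | If of expr & cmd & cmd
  | While of expr & cmd.

Record state := State {
  regs : nat -> nat;
  arrs : nat -> nat -> nat;
  output : seq nat
}.

Definition eval_op (W : nat) (o : binop) (x y : nat) : nat :=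
  match o with
  | OpAdd => (x + y) %% W
  | OpSub => x - y
  | OpMul => (x * y) %% W
  | OpDiv => x %/ y
  | OpMod => x %% y
  | OpEq => (x == y : nat)
  | OpLt => (x < y : nat)
  end.

Fixpoint eval (W : nat) (s : state) (e : expr) : nat :=
  match e with
  | Cst n => n %% W
  | Reg i => regs s i
  | Arr k e1 => arrs s k (eval W s e1)
  | Bin o e1 e2 => eval_op W o (eval W s e1) (eval W s e2)
  end.

Fixpoint cost (e : expr) : nat :=
  match e with
  | Cst _ | Reg _ => 1
  | Arr _ e1 => (cost e1).+1
  | Bin _ e1 e2 => (cost e1 + cost e2).+1
  end.

Definition set_reg (s : state) (i v : nat) : state :=
  State (fun j => if j == i then v else regs s j) (arrs s) (output s).

Definition set_arr (s : state) (k i v : nat) : state :=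
  State (regs s)
    (fun k' j => if (k' == k) && (j == i) then v else arrs s k' j)
    (output s).

Definition emit (s : state) (v : nat) : state :=
  State (regs s) (arrs s) (rcons (output s) v).

(* [exec W c s t s']: with words modulo W, the program c started in s halts in
   s' after exactly t time units. *)
Inductive exec (W : nat) : cmd -> state -> nat -> state -> Prop :=
  | ExecSkip s : exec W Skip s 1 s
  | ExecAssign s i e :
      exec W (Assign i e) s (cost e).+1 (set_reg s i (eval W s e))
  | ExecStore s k e1 e2 :
      exec W (Store k e1 e2) s (cost e1 + cost e2).+1
        (set_arr s k (eval W s e1) (eval W s e2))
  | ExecEmit s e :
      exec W (Emit e) s (cost e).+1 (emit s (eval W s e))
  | ExecSeq c1 c2 s s1 s2 t1 t2 :
      exec W c1 s t1 s1 -> exec W c2 s1 t2 s2 ->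
      exec W (Seq c1 c2) s (t1 + t2) s2
  | ExecIfTrue e c1 c2 s s1 t :
      eval W s e != 0 -> exec W c1 s t s1 ->
      exec W (If e c1 c2) s ((cost e).+1 + t) s1
  | ExecIfFalse e c1 c2 s s1 t :
      eval W s e = 0 -> exec W c2 s t s1 ->
      exec W (If e c1 c2) s ((cost e).+1 + t) s1
  | ExecWhileFalse e c s :
      eval W s e = 0 -> exec W (While e c) s (cost e).+1 s
  | ExecWhileTrue e c s s1 s2 t1 t2 :
      eval W s e != 0 -> exec W c s t1 s1 -> exec W (While e c) s1 t2 s2 ->
      exec W (While e c) s ((cost e).+1 + t1 + t2) s2.

Lemma exec_det W c s t1 s1 t2 s2 :
  exec W c s t1 s1 -> exec W c s t2 s2 -> t1 = t2 /\ s1 = s2.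
Proof.
move=> E; elim: E t2 s2 => {c s t1 s1}; intros;
  match goal with H : exec _ _ _ _ _ |- _ => inversion H; subst end => //;
  repeat match goal with
  | H1 : is_true (eval ?W ?s ?e != 0), H2 : eval ?W ?s ?e = 0 |- _ =>
      by rewrite H2 in H1
  | IH : forall t s, exec ?W ?c ?s0 t s -> _ /\ _, H : exec ?W ?c ?s0 _ _ |- _ =>
      case: (IH _ _ H) => ? ?; subst; clear IH
  end; by [].
Qed.

Definition init_state (N a b : nat) : state :=
  State (nth 0 [:: N; a; b]) (fun _ _ => 0) [::].

(* Words have kappa times as many bits as the largest input. *)
Definition word_modulus (kappa N a b : nat) : nat :=
  2 ^ (kappa * (trunc_log 2 (maxn N (maxn a b))).+1).

(* On input N, a, b the program outputs the matrix of an
   (N, a, b, l)_q-Hit and Miss hash family and halts after t time units. *)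
Definition computes_HM (q kappa : nat) (prog : cmd) (N a b l t : nat) : Prop :=
  exists h : 'I_l -> 'I_N -> 'I_q, exists s : state,
    [/\ HM_family a b h,
        exec (word_modulus kappa N a b) prog (init_state N a b) t s
      & output s = matrix_listing h].

Section Asymptotics.
Variable R : realType.
Local Open Scope ring_scope.
Local Open Scope classical_set_scope.

Definition log2 (x : R) : R := ln x / ln 2.

(* f(N) = N^{o(1)} *)
Definition subpolynomial (f : nat -> nat) : Prop :=
  exists2 e : R ^nat, e @ \oo --> (0 : R) &
    \forall N \near \oo, (f N)%:R = N%:R `^ e N :> R.

(* f(N) = Omega(log N) *)
Definition Omega_log (f : nat -> nat) : Prop :=
  (fun N : nat => (f N)%:R : R^o) \is
    'Omega_\oo (fun N : nat => log2 N%:R : R^o).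

Definition polynomially_large (f : nat -> nat) : Prop :=
  exists2 c : nat, (0 < c)%N &
    \forall N \near \oo, N%:R `^ (c%:R^-1) <= (f N)%:R :> R.

Definition at_most_log (f : nat -> nat) : Prop :=
  \forall N \near \oo, (f N)%:R <= log2 N%:R.

End Asymptotics.

(* Main.v *)
Require Import Defs.
From HB Require Import structures.
From mathcomp Require Import all_boot all_order all_algebra.
From mathcomp Require Import zify.
Set Implicit Arguments.
Unset Strict Implicit.
Unset Printing Implicit Defensive.

(** Let [m = a b].  A code of length [r] over [q] symbols whose distinct words
    agree in fewer than [r / m] places separates [A] from [B] at some coordinate
    [i], by a union bound over [A x B]; sending the at most [b] symbols taken by
    [B] at [i] to 1 and all others to 0 then separates [A] from [B] with two
    values.  This gives [r q^b] rows: one for each coordinate and each [b]-tuple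
    of symbols.

    Let [c] be least with [N <= a^c].  Reed-Solomon words of degree below [c] over
    the field of prime order [Q = O(m c)] give [Q^(b+1)] rows.  Alternatively,
    Reed-Solomon words over a field of order [O(m log N)], evaluated at
    [2 m log_Q N] points, are concatenated with [Q] words of length [O(m log Q)]
    over [8 m] symbols with agreement at most [1 / (2 m)].  These are found
    greedily: column by column, each word receives the symbol that minimizes the
    sum of [2^agreement] over the earlier words sharing it, so that the total
    weight grows by a factor at most [1 + 1/q] per column.  The result has
    [O(m^2 log N) (8 m)^b] rows.

    The program takes the first code exactly when [c^(b+1) <= m log N]; with this
    rule all the bounds hold at every [N > 1], whichever regime the sequences
    [a] and [b] are in, and the running time is [O(N log^2 N)] per row. *)

(** No single [N] reveals which regime the sequences [a] and [b] are in, so the program compares the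
    two codes themselves. Both have at most [O(m)^(b+1)] rows times a further factor, [c^(b+1)] for
    the first code and [m log N] for the second, and the test selects the smaller factor. Every
    stated bound follows from this minimum, the last one because [c] is capped at the number of
    binary digits of [N].

    Three costs shape the program. The row index ranges over [r q^b] values and does not fit into a
    word, so it is kept as an odometer of base-[q] digits. Preprocessing is charged to the output:
    the search for the prime, quadratic in the bound on it, and the construction of the inner code
    both take [O(N + log^2 N * rows)] or less up to constants. Replacing [a] and [b] by their
    minimum with [N] keeps [m] at most [N^2], so that words of [O(log N)] bits suffice even for the
    weights of the greedy choice. *)

Local Open Scope nat_scope.

(** * A weak form of Bertrand's postulate *)

Lemma logn_bin_double p n : prime p -> 0 < n ->
  logn p 'C(n.*2, n) = \sum_(1 <= k < n.*2.+1) (n.*2 %/ p ^ k - (n %/ p ^ k).*2).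
Proof.
move=> pp n0.
have e: logn p 'C(n.*2, n) + (logn p n`!).*2 = logn p (n.*2)`!.
  have nn : n <= n.*2 by lia.
  have e1 : n.*2 - n = n by lia.
  rewrite -(bin_fact nn) e1 !lognM ?muln_gt0 ?fact_gt0 ?bin_gt0 //.
  by rewrite addnn.
rewrite !logn_fact // in e.
have e2: \sum_(1 <= k < n.+1) n %/ p ^ k = \sum_(1 <= k < n.*2.+1) n %/ p ^ k.
  rewrite [RHS](@big_cat_nat _ _ _ n.+1) //=; try lia.
  rewrite [X in _ + X]big_nat [X in _ + X]big1 ?addn0 // => i /andP[hi _].
  apply: divn_small; apply: leq_trans hi _.
  exact: ltnW (ltn_expl _ (prime_gt1 pp)).
rewrite e2 in e.
apply/eqP; rewrite -(eqn_add2r (\sum_(1 <= k < n.*2.+1) n %/ p ^ k).*2) e.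
rewrite -!mul2n big_distrr /= -big_split /=; apply/eqP/eq_bigr => k _.
have h := leq_divM n (p ^ k).
have pk : 0 < p ^ k by rewrite expn_gt0 prime_gt0.
have : (n %/ p ^ k).*2 <= n.*2 %/ p ^ k by rewrite leq_divRL //; nia.
lia.
Qed.

Lemma divn_double_leq d n : 0 < d -> n.*2 %/ d - (n %/ d).*2 <= 1.
Proof.
move=> d0; rewrite {1}(divn_eq n d) doubleD doubleMl divnMDl //.
have h := ltn_pmod n d0.
have : (n %% d).*2 %/ d <= 1 by rewrite -ltnS ltn_divLR //; lia.
lia.
Qed.

(** Only the powers of [p] up to [n.*2] contribute to Legendre's sum, and each contributes at most
    1. *)
Lemma logn_bin_double_leq p n : prime p -> 0 < n ->
  p ^ logn p 'C(n.*2, n) <= n.*2.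
Proof.
move=> pp n0.
apply: (@leq_trans (p ^ trunc_log p n.*2)); last first.
  by apply: trunc_logP; rewrite ?prime_gt1 //; lia.
rewrite leq_pexp2l ?prime_gt0 // logn_bin_double //.
set t := trunc_log p n.*2.
have tn : t <= n.*2.
  apply: leq_trans (ltnW (ltn_expl t (prime_gt1 pp))) _.
  by apply: trunc_logP; rewrite ?prime_gt1 //; lia.
rewrite (@big_cat_nat _ _ _ t.+1) //=.
rewrite [X in _ + X]big_nat [X in _ + X]big1 ?addn0; last first.
  move=> i /andP[hi _]; rewrite divn_small //.
  apply: leq_trans (trunc_log_ltn _ (prime_gt1 pp)) _.
  by rewrite leq_pexp2l ?prime_gt0.
apply: (@leq_trans (\sum_(1 <= k < t.+1) 1)); last first.
  by rewrite sum_nat_const_nat; lia.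
by apply: leq_sum => k _; rewrite divn_double_leq // expn_gt0 prime_gt0.
Qed.

Lemma leq_exp2_bin_double n : 2 ^ n <= 'C(n.*2, n).
Proof.
elim: n => [|n IH] //.
rewrite doubleS !binS expnS.
have h1 : 'C(n.*2, n.+1) = 'C(n.*2, n.-1) \/ n = 0.
  case: n {IH} => [|n]; [by right|left].
  rewrite -bin_sub; first by congr 'C(_, _); lia.
  lia.
have h2 : 'C(n.*2.+1, n) + 'C(n.*2.+1, n.+1) >= 'C(n.*2, n) * 2.
  rewrite binS; case: n {IH h1} => [|n] //; rewrite binS; lia.
move: IH h2; rewrite ?binS; lia.
Qed.

Lemma bin_double_leq_exp4 n : 'C(n.*2, n) <= 4 ^ n.
Proof.
have -> : 4 ^ n = 2 ^ n.*2 by rewrite -mul2n expnM.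
rewrite -[2]/(1 + 1) expnDn.
have h : n < n.*2.+1 by lia.
by rewrite (bigD1 (Ordinal h)) //= !exp1n !muln1 leq_addr.
Qed.

(** Non-primes have [logn] zero, so the product may run over all indices; index 0 contributes
    [0 ^ 0 = 1]. *)
Lemma prod_pfactor n m : 0 < n -> n <= m ->
  n = \prod_(0 <= p < m.+1) p ^ logn p n.
Proof. by move=> n0 nm; rewrite -(widen_partn predT nm) partnT. Qed.

(** A prime in [(n, 2n]] divides the central binomial coefficient, which is at most [4 ^ n]. *)
Lemma prod_prime_double_leq n : 0 < n ->
  \prod_(n.+1 <= p < n.*2.+1 | prime p) p <= 4 ^ n.
Proof.
move=> n0; apply: leq_trans (bin_double_leq_exp4 n).
set C := 'C(n.*2, n).
have C0 : 0 < C by rewrite bin_gt0; lia.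
rewrite [leqRHS](prod_pfactor C0 (leq_addr n.*2 C)).
have F0 p : 0 < p ^ logn p C.
  by case: p => [|p]; rewrite ?expn_gt0 // lognE.
rewrite [leqRHS](@big_cat_nat _ _ _ n.+1) //=; last by lia.
rewrite [X in _ <= _ * X](@big_cat_nat _ _ _ n.*2.+1) //=; [|lia|lia].
apply: (@leq_trans (1 * (\prod_(n.+1 <= p < n.*2.+1 | prime p) p * 1))).
  by rewrite mul1n muln1.
apply: leq_mul; first by apply: prodn_gt0.
apply: leq_mul; last by apply: prodn_gt0.
rewrite big_mkcond /= big_nat_cond [leqRHS]big_nat_cond.
apply: leq_prod => p; rewrite andbT => /andP[np pn]; case: ifP => [pp|_] //.
rewrite -{1}(expn1 p); apply: (leq_pexp2l (prime_gt0 pp)).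
rewrite logn_bin_double //.
rewrite big_ltn; last by lia.
rewrite expn1 (divn_small np) double0 subn0.
by rewrite ltn_addr // divn_gt0 ?(prime_gt0 pp).
Qed.

Lemma primorial_exp2_leq r :
  \prod_(0 <= p < (2 ^ r).+1 | prime p) p <= 4 ^ (2 ^ r).
Proof.
elim: r => [|r IH].
  by rewrite big_mkcond !big_nat_recr // big_geq.
rewrite (@big_cat_nat _ _ _ (2 ^ r).+1) //=; last by rewrite expnS; lia.
have -> : 4 ^ (2 ^ r.+1) = 4 ^ (2 ^ r) * 4 ^ (2 ^ r).
  by rewrite -expnD expnS mul2n addnn.
apply: leq_mul => //; rewrite expnS mul2n.
by apply: prod_prime_double_leq; rewrite expn_gt0.
Qed.

(** Erdős's argument. Without primes between [2 ^ r] and [2 ^ u], the central binomial coefficient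
    of [2 ^ u] would have too few prime factors to reach its lower bound. The wide window makes
    crude estimates sufficient. *)
Lemma bertrand_exp2 r : exists2 p, prime p & 2 ^ r < p <= 2 ^ (r + 16).
Proof.
set u := r + 16; have uE : u = r + 16 by []; clearbody u; set t := u./2.+1.
have [/existsP[p /andP[pp rp]]|/existsPn no] :=
  boolP [exists p : 'I_(2 ^ u).+1, prime p && (2 ^ r < p)].
  by exists p => //; apply/andP; split=> //; have := ltn_ord p; rewrite ltnS.
pose n := 2 ^ u.-1; set C := 'C(n.*2, n).
have n0 : 0 < n by rewrite expn_gt0.
have n2 : n.*2 = 2 ^ u by rewrite -mul2n -expnS prednK // uE addnC.
have C0 : 0 < C by rewrite bin_gt0; lia.
have F0 p : 0 < p ^ logn p C.
  by case: p => [|p]; rewrite ?expn_gt0 // lognE.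
(* A common index range for the factorization of [C] and the two products bounding it. *)
pose M := C + 2 ^ t + 2 ^ r.
have CM : C <= M by rewrite /M; lia.
have tM : 2 ^ t <= M.+1 by rewrite /M; lia.
have rM : (2 ^ r).+1 <= M.+1 by rewrite /M; lia.
(* Primes up to [2 ^ t] contribute at most [2 ^ u] each to [C], the others
   at most once. *)
have up : C <= 2 ^ (u * 2 ^ t) * 4 ^ (2 ^ r).
  rewrite [leqLHS](prod_pfactor C0 CM).
  apply: leq_trans (leq_mul (leqnn _) (primorial_exp2_leq r)).
  have -> : 2 ^ (u * 2 ^ t) = \prod_(0 <= p < 2 ^ t) 2 ^ u.
    by rewrite prod_nat_const_nat subn0 expnM.
  rewrite (@big_nat_widen _ _ _ 0 (2 ^ t) M.+1) //.
  rewrite (@big_nat_widen _ _ _ 0 (2 ^ r).+1 M.+1) //.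
  rewrite [X in _ <= X * _]big_mkcond [X in _ <= _ * X]big_mkcond -big_split /=.
  apply: leq_prod => p _.
  have [pp|npp] := boolP (prime p); last first.
    have -> : logn p C = 0 by rewrite lognE (negPf npp).
    by rewrite expn0 muln1; case: ifP => _; rewrite ?expn_gt0.
  have pl := logn_bin_double_leq pp n0; rewrite -/C n2 in pl.
  rewrite ltnS; case: (ltnP p (2 ^ t)) => pt.
    by apply: leq_trans pl _; rewrite leq_pmulr //; case: ifP => // _;
      exact: prime_gt0.
  have l1 : logn p C <= 1.
    rewrite leqNgt; apply/negP => l2.
    have : p ^ 2 <= 2 ^ u by apply: leq_trans pl; rewrite leq_pexp2l ?prime_gt0.
    apply/negP; rewrite -ltnNge.
    apply: (@leq_trans ((2 ^ t) ^ 2)); last by rewrite leq_exp2r.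
    by rewrite -expnM ltn_exp2l // /t; lia.
  rewrite mul1n andTb; case: (leqP p (2 ^ r)) => pr.
    by apply: leq_trans (leq_pexp2l (prime_gt0 pp) l1) _; rewrite expn1.
  move: l1 pl; case: (logn p C) => [|[|//]] // _; rewrite expn1 => pu.
  have pu' : p < (2 ^ u).+1 by [].
  by have := no (Ordinal pu'); rewrite pp /= pr.
have := leq_trans (leq_exp2_bin_double n) up.
have -> : 4 ^ (2 ^ r) = 2 ^ (2 * 2 ^ r) by rewrite expnM.
rewrite -expnD leq_exp2l // /n => bad.
exfalso; move: bad; apply/negP; rewrite -ltnNge.
(* Used at [v = u./2], which is at least 8 because of the shift 16. It gives
   [u * 2 ^ t <= 2 ^ (u - 2)], half of the exponent [2 ^ u.-1] to be beaten. *)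
have uP v : 8 <= v -> v.*2.+1 <= 2 ^ (v - 3).
  move=> v8; rewrite -(subnK v8); elim: (v - 8) => [|w]; first by [].
  have -> : w.+1 + 8 - 3 = (w + 8 - 3).+1 by lia.
  rewrite expnS; lia.
have u2 : u <= 2 ^ (uphalf u - 3).
  apply: leq_trans (leq_trans (uP u./2 _) _); rewrite uE; first by lia.
    by lia.
  by rewrite leq_exp2l //; lia.
have e1 : 2 ^ u.-1 = 2 * 2 ^ (u - 2) by rewrite -expnS; congr (_ ^ _); rewrite uE;
  lia.
have e2 : 2 * 2 ^ r < 2 ^ (u - 2).
  by rewrite -expnS ltn_exp2l // uE; lia.
have e3 : u * 2 ^ t <= 2 ^ (u - 2).
  apply: leq_trans (leq_mul u2 (leqnn _)) _.
  by rewrite -expnD leq_exp2l // /t uE; lia.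
by rewrite e1; lia.
Qed.

Lemma weak_bertrand : exists2 C, 0 < C &
  forall n, 0 < n -> exists2 p, prime p & n < p <= C * n.
Proof.
(* Makes the shift opaque, so that [2 ^ s.+1] cannot unfold to a large unary number. *)
have [s sP] : exists s, forall r, exists2 p, prime p & 2 ^ r < p <= 2 ^ (r + s).
  by exists 16 => r; apply: bertrand_exp2.
exists (2 ^ s.+1); first by rewrite expn_gt0.
move=> n n0; have [p pp /andP[p1 p2]] := sP (trunc_log 2 n).+1.
exists p => //; rewrite (ltn_trans (trunc_log_ltn _ _) p1) //=.
apply: leq_trans p2 _; rewrite addSnnS expnD mulnC leq_mul2l.
by rewrite trunc_logP ?orbT.
Qed.

(** * Codes with small agreement *)

Lemma leq_expn2r m n e : m <= n -> m ^ e <= n ^ e.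
Proof. by case: e => // e mn; rewrite leq_exp2r. Qed.

Lemma sum1_ord n : \sum_(i < n) 1 = n.
Proof. by rewrite sum_nat_const card_ord muln1. Qed.

Lemma digits_inj Q k x y : 0 < Q -> x < Q ^ k -> y < Q ^ k ->
  (forall t, t < k -> x %/ Q ^ t %% Q = y %/ Q ^ t %% Q) -> x = y.
Proof.
move=> Q0; elim: k x y => [|k IH] x y; first by rewrite expn0; lia.
rewrite expnS => xQ yQ dxy.
rewrite (divn_eq x Q) (divn_eq y Q).
have := dxy 0 isT; rewrite expn0 !divn1 => ->.
congr (_ * _ + _); apply: IH; rewrite ?ltn_divLR //; try by rewrite mulnC.
by move=> t tk; have := dxy t.+1 tk; rewrite expnS !divnMA.
Qed.

Lemma digits_surj q b (s : nat -> nat) : (forall t, t < b -> s t < q) ->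
  exists2 v, v < q ^ b & forall t, t < b -> v %/ q ^ t %% q = s t.
Proof.
elim: b s => [|b IH] s sq; first by exists 0.
have [v vq vs] := IH (s \o succn) (fun t tb => sq t.+1 tb).
have s0 := sq 0 isT; have q0 : 0 < q by lia.
exists (v * q + s 0); first by rewrite expnS; nia.
case=> [|t] tb; first by rewrite expn0 divn1 modnMDl modn_small.
by rewrite expnS divnMA divnMDl // (divn_small s0) addn0 vs.
Qed.

(** Reed-Solomon encoding: the base-[Q] digits of [x] are the coefficients of a polynomial,
    evaluated at [e] modulo [Q]. Staying in [nat] makes it directly computable by the program. *)
Definition rs_eval (Q k x e : nat) : nat :=
  (\sum_(t < k) x %/ Q ^ t %% Q * e ^ t) %% Q.

Section ReedSolomon.
Import GRing.Theory.
Local Open Scope ring_scope.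

(** Agreements are roots of the difference of the two polynomials, nonzero since some digit differs;
    [n <= Q] makes the evaluation points distinct in the field. *)
Lemma rs_eval_agree (Q k x y n : nat) : prime Q -> (n <= Q)%N ->
  (x < Q ^ k)%N -> (y < Q ^ k)%N -> x != y ->
  (\sum_(e < n) (rs_eval Q k x e == rs_eval Q k y e) <= k.-1)%N.
Proof.
move=> Qp nQ xk yk xy.
have Q1 := prime_gt1 Qp.
pose dg z t : 'F_Q := (z %/ Q ^ t %% Q)%:R.
pose P : {poly 'F_Q} := \poly_(t < k) (dg x t - dg y t).
have nat_inj u v : (u < Q)%N -> (v < Q)%N -> u%:R = v%:R :> 'F_Q -> u = v.
  move=> uQ vQ /(congr1 (fun w : 'F_Q => w : nat)).
  by rewrite !val_Fp_nat // !modn_small.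
have P0 : P != 0.
  apply/eqP => P0; move/eqP: xy; apply.
  apply: (@digits_inj Q k) => //; first by rewrite prime_gt0.
  move=> t tk; apply: nat_inj; rewrite ?ltn_mod ?prime_gt0 //.
  have : P`_t = 0 by rewrite P0 coef0.
  by rewrite coef_poly tk => /eqP; rewrite subr_eq0 => /eqP.
have evalE z e : (rs_eval Q k z e)%:R = \sum_(t < k) dg z t * e%:R ^+ t :> 'F_Q.
  rewrite /rs_eval Fp_nat_mod // natr_sum.
  by apply: eq_bigr => t _; rewrite natrM natrX.
pose s : seq 'F_Q := map (fun e : 'I_n => (e : nat)%:R)
  (filter (fun e : 'I_n => rs_eval Q k x e == rs_eval Q k y e) (enum 'I_n)).
have ss : size s = (\sum_(e < n) (rs_eval Q k x e == rs_eval Q k y e))%N.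
  rewrite size_map size_filter -sum1_count big_enum_cond /= big_mkcond /=.
  by apply: eq_bigr => e _; case: eqP.
have us : uniq s.
  rewrite map_inj_in_uniq; first exact/filter_uniq/enum_uniq.
  move=> e f _ _ ef.
  by apply/val_inj/nat_inj => //; apply: leq_trans (ltn_ord _) nQ.
have rP : all (root P) s.
  apply/allP => z /mapP[e]; rewrite mem_filter => /andP[/eqP ef _] ->.
  rewrite /root horner_poly.
  rewrite (eq_bigr _ (fun t _ => mulrBl _ _ _)).
  by rewrite sumrB -!evalE ef subrr.
have := max_poly_roots P0 rP us; rewrite ss => h.
have := leq_trans h (size_poly _ _); case: (k) => //.
Qed.

End ReedSolomon.

(** * Greedy construction of the inner code *)

Definition agree (T : nat -> nat -> nat) (j x y : nat) : nat :=
  \sum_(i < j) (T x i == T y i).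

(** The potential driving the greedy choice: an exponential moment that dominates [2 ^ agree] for
    every single earlier word. *)
Definition weight (T : nat -> nat -> nat) (j x : nat) : nat :=
  \sum_(y < x) 2 ^ agree T j x y.

(* Symbol [j] of word [x] is chosen no worse than a uniformly random one. *)
Definition greedy (q : nat) (T : nat -> nat -> nat) (x j : nat) : Prop :=
  T x j < q /\
  q * (\sum_(y < x) (T y j == T x j) * 2 ^ agree T j x y) <= weight T j x.

(** A new column doubles exactly the terms of the earlier words sharing the symbol of [x], and these
    carry at most a fraction [1 / q] of the weight. *)
Lemma weightS q T j x : greedy q T x j ->
  q * weight T j.+1 x <= q.+1 * weight T j x.
Proof.
move=> [_ h]; rewrite mulSn addnC.
have -> : weight T j.+1 x = weight T j x +
    \sum_(y < x) (T y j == T x j) * 2 ^ agree T j x y.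
  rewrite -big_split; apply: eq_bigr => y _ /=.
  rewrite {1}/agree big_ord_recr /= -/(agree T j x y) eq_sym.
  by case: eqP => _; rewrite ?addn0 ?addn1 ?expnS; lia.
by rewrite mulnDr leq_add2l.
Qed.

Lemma weight_leq q T j x : (forall i, i < j -> greedy q T x i) ->
  q ^ j * weight T j x <= q.+1 ^ j * x.
Proof.
elim: j => [|j IH] g.
  rewrite !mul1n -[leqRHS]sum1_ord; apply: leq_sum => y _.
  by rewrite /agree big_ord0.
have {}IH := IH (fun i ij => g i (ltnW ij)).
have h := weightS (g j (ltnSn j)).
rewrite !expnS; nia.
Qed.

Lemma exp2_agree_weight T j x y : y < x -> 2 ^ agree T j x y <= weight T j x.
Proof.
by move=> yx; rewrite /weight (bigD1 (Ordinal yx)) //= leq_addr.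
Qed.

Lemma agreeC T j x y : agree T j x y = agree T j y x.
Proof. by apply: eq_bigr => i _; rewrite eq_sym. Qed.

Lemma agree_lt q B T j x : 0 < q ->
  (forall i, i < j -> greedy q T x i) ->
  q.+1 ^ j * x < 2 ^ B * q ^ j -> forall z, z < x -> agree T j x z < B.
Proof.
move=> q0 g hB z zx.
have h := leq_ltn_trans (weight_leq g) hB.
rewrite mulnC ltn_pmul2r ?expn_gt0 ?q0 // in h.
have := leq_ltn_trans (exp2_agree_weight T j zx) h.
by rewrite ltn_exp2l.
Qed.

(** Bernoulli's inequality [(1 - 1/(q+1))^h >= 1 - h/(q+1)] with denominators cleared. *)
Lemma expnS_bernoulli q h : h <= q.+1 ->
  q.+1 ^ h * (q.+1 - h) <= q ^ h * q.+1.
Proof.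
elim: h => [|h IH] hq; first by rewrite subn0.
have {}IH := IH (ltnW hq).
have : q.+1 * (q.+1 - h.+1) <= q * (q.+1 - h) by nia.
rewrite !expnS; move: (q.+1 - h.+1) (q.+1 - h) (q.+1 ^ h) (q ^ h) IH => u v E F; nia.
Qed.

Lemma expnS_leq_double q h : h.*2 <= q.+1 -> q.+1 ^ h <= 2 * q ^ h.
Proof.
move=> hq; have h1 : h <= q.+1 by lia.
have := expnS_bernoulli h1.
have : q.+1 <= 2 * (q.+1 - h) by lia.
move: (q.+1 - h) (q.+1 ^ h) (q ^ h) => u E F; nia.
Qed.

(** Each batch of [h] columns at most doubles the weight. An incomplete last batch is handled by
    enlarging [j] to [h * r] and cancelling the surplus factors. *)
Lemma expnS_leq_exp2 q h r j : 0 < q -> h.*2 <= q.+1 -> j <= h * r ->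
  q.+1 ^ j <= 2 ^ r * q ^ j.
Proof.
move=> q0 hq jr.
have h1 : q.+1 ^ (h * r) <= 2 ^ r * q ^ (h * r).
  by rewrite !expnM -expnMn leq_expn2r // expnS_leq_double.
have e : h * r = j + (h * r - j) by lia.
rewrite e !expnD in h1.
have h2 : q ^ (h * r - j) <= q.+1 ^ (h * r - j) by rewrite leq_expn2r.
have h3 : 0 < q.+1 ^ (h * r - j) by rewrite expn_gt0.
move: h1 h2 h3; move: (q.+1 ^ _) (q.+1 ^ _) (q ^ _) (q ^ j) (2 ^ r) => u v w z k; nia.
Qed.

(** * From codes to Hit and Miss families *)

Definition in_digits (q b i v : nat) : bool :=
  v \in [seq i %/ q ^ t %% q | t <- iota 0 b].

(* Row [i] of the family: its base-[q] digits of rank below [b] name the symbols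
   sent to 1, and [i %/ q ^ b] is the coordinate of the code. *)
Definition code_hash (q b : nat) (sym : nat -> nat -> nat) (i x : nat) : bool :=
  in_digits q b i (sym x (i %/ q ^ b)).

Lemma exists_separating_coordinate (N a b r : nat) (sym : nat -> nat -> nat)
    (A B : {set 'I_N}) : 0 < a * b -> #|A| <= a -> #|B| <= b ->
  [disjoint A & B] ->
  (forall x y, x < N -> y < N -> x != y ->
     a * b * (\sum_(i < r) (sym x i == sym y i)) < r) ->
  0 < r ->
  exists2 i, i < r &
    forall x y : 'I_N, x \in A -> y \in B -> sym x i != sym y i.
Proof.
move=> ab0 Aa Bb dAB H r0.
have [/existsP[i /forallP h]|/existsPn no] :=
  boolP [exists i : 'I_r, [forall x in A, [forall y in B, sym x i != sym y i]]].
  exists i => // x y xA yB.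
  by move: (h x) => /implyP /(_ xA) /forallP/(_ y)/implyP; apply.
exfalso; pose E x y := \sum_(i < r) (sym x i == sym y i).
(* If every coordinate had a clash, the clashes over [A x B] would number at least [r]. *)
have : r <= \sum_(x in A) \sum_(y in B) E x y.
  under eq_bigr => x _ do rewrite exchange_big /=.
  rewrite exchange_big /= -[leqLHS](sum1_ord r).
  apply: leq_sum => i _; have := no i.
  rewrite negb_forall => /existsP[x]; rewrite negb_imply => /andP[xA].
  rewrite negb_forall => /existsP[y]; rewrite negb_imply negbK => /andP[yB exy].
  by rewrite (bigD1 x) //= (bigD1 y) //= exy.
apply/negP; rewrite -ltnNge -(ltn_pmul2l ab0).
rewrite big_distrr /=.
(* Each pair is charged [r.-1], since a strict inequality would not survive a sum over a possibly
   empty set of pairs. *)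
apply: (@leq_ltn_trans (\sum_(x in A) \sum_(y in B) r.-1)).
  apply: leq_sum => x xA; rewrite big_distrr /=; apply: leq_sum => y yB.
  rewrite -ltnS prednK //; apply: H => //.
  apply/negP => /eqP/val_inj xy; move/pred0P: dAB => /(_ x).
  by rewrite /= xA xy yB.
rewrite !sum_nat_const mulnA; apply: (@leq_ltn_trans (a * b * r.-1)).
  by rewrite leq_mul2r leq_mul ?orbT.
by rewrite ltn_pmul2l // prednK.
Qed.

Lemma code_HM_family N a b r q (sym : nat -> nat -> nat) (h : 'I_(r * q ^ b) -> 'I_N
  -> 'I_2) :
  0 < a -> 0 < b -> 0 < r -> 0 < q ->
  (forall x i, x < N -> i < r -> sym x i < q) ->
  (forall x y, x < N -> y < N -> x != y ->
     a * b * (\sum_(i < r) (sym x i == sym y i)) < r) ->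
  (forall i x, h i x = code_hash q b sym i x :> nat) ->
  HM_family a b h.
Proof.
move=> a0 b0 r0 q0 symq H hE A B dAB Aa Bb.
have ab0 : 0 < a * b by rewrite muln_gt0 a0.
have [i ir sep] := exists_separating_coordinate ab0 Aa Bb dAB H r0.
have [->|[y0 y0B]] := set_0Vmem B.
  have l0 : 0 < r * q ^ b by rewrite muln_gt0 r0 expn_gt0 q0.
  by exists (Ordinal l0) => x y _; rewrite inE.
(* The default [y0] pads [B] to [b] entries by one of its own elements; repeated digits are
   harmless, as [in_digits] tests membership only. *)
pose s t := sym (nth y0 (enum B) t) i.
have sq t : t < b -> s t < q by move=> _; apply: symq.
have [v vq vs] := digits_surj sq.
have lt : i * q ^ b + v < r * q ^ b by nia.
have qb0 : 0 < q ^ b by rewrite expn_gt0 q0.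
have dv : (i * q ^ b + v) %/ q ^ b = i by rewrite divnMDl // divn_small // addn0.
have dg t : t < b -> (i * q ^ b + v) %/ q ^ t %% q = s t.
  move=> tb; rewrite -vs // -(subnK (ltnW tb)) expnD mulnA divnMDl ?expn_gt0 ?q0 //.
  have -> : b - t = (b - t.+1).+1 by lia.
  by rewrite expnSr mulnA modnMDl.
exists (Ordinal lt) => x y xA yB; rewrite -val_eqE /= !hE /code_hash /in_digits dv.
have -> : sym y i \in [seq (i * q ^ b + v) %/ q ^ t %% q | t <- iota 0 b].
  apply/mapP; exists (index y (enum B)); last first.
    rewrite dg; last by apply: leq_trans Bb; rewrite cardE index_mem mem_enum.
    by rewrite /s nth_index ?mem_enum.
  by rewrite mem_iota add0n; apply: leq_trans Bb; rewrite cardE index_mem mem_enum.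
case: mapP => // -[t]; rewrite mem_iota add0n /= => tb; rewrite dg // /s => e.
have tB : nth y0 (enum B) t \in B.
  have [tB|tB] := ltnP t (size (enum B)); first by rewrite -mem_enum mem_nth.
  by rewrite nth_default.
by have := sep _ _ xA tB; rewrite e eqxx.
Qed.

(** Both regimes share this form: for the bare Reed-Solomon code, [n2 = 1] and [T] merely relabels
    the [Q] symbols injectively. *)
Definition code_symbol (Q k n2 : nat) (T : nat -> nat -> nat) (x r : nat) : nat :=
  T (rs_eval Q k x (r %/ n2)) (r %% n2).

(** At most [k.-1] outer positions agree and cost a full block of length [n2]; any other costs at
    most [d]. *)
Lemma concat_code_agree (Q k n1 n2 d m : nat) (T : nat -> nat -> nat) (N x y : nat) :
  prime Q -> n1 <= Q -> N <= Q ^ k -> x < N -> y < N -> x != y ->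
  0 < n2 ->
  (forall u v, u < Q -> v < Q -> u != v -> agree T n2 u v <= d) ->
  m * (k.-1 * n2 + n1 * d) < n1 * n2 ->
  m * (\sum_(i < n1 * n2)
    (code_symbol Q k n2 T x i == code_symbol Q k n2 T y i)) < n1 * n2.
Proof.
move=> Qp nQ NQ xN yN xy n20 Td; apply: leq_ltn_trans; rewrite leq_mul2l; apply/orP;
  right.
have rsQ z e : rs_eval Q k z e < Q by rewrite ltn_mod prime_gt0.
have -> : \sum_(i < n1 * n2)
    (code_symbol Q k n2 T x i == code_symbol Q k n2 T y i)
  = \sum_(e < n1) agree T n2 (rs_eval Q k x e) (rs_eval Q k y e).
  elim: (n1) => [|n IH]; first by rewrite !big_ord0.
  rewrite big_ord_recr /= -IH mulSn addnC big_split_ord /=; congr (_ + _).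
  by apply: eq_bigr => j _;
    rewrite /code_symbol divnMDl // modnMDl divn_small // addn0 modn_small.
apply: (@leq_trans (\sum_(e < n1) ((rs_eval Q k x e == rs_eval Q k y e) * n2 + d))).
  apply: leq_sum => e _; have [->|ne] := eqVneq; last by rewrite mul0n Td.
  rewrite mul1n; apply: leq_trans (leq_addr _ _).
  by rewrite /agree -[leqRHS](sum1_ord n2); apply: leq_sum => i _; rewrite eqxx.
rewrite big_split /= -big_distrl /= sum_nat_const card_ord leq_add2r leq_mul2r.
by rewrite rs_eval_agree ?orbT //; apply: leq_trans NQ.
Qed.

(** * Program logic with running times *)

Fixpoint written_regs (c : cmd) : seq nat :=
  match c with
  | Assign i _ => [:: i]
  | Seq c1 c2 | If _ c1 c2 => written_regs c1 ++ written_regs c2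
  | While _ c1 => written_regs c1
  | _ => [::]
  end.

Fixpoint written_arrs (c : cmd) : seq nat :=
  match c with
  | Store k _ _ => [:: k]
  | Seq c1 c2 | If _ c1 c2 => written_arrs c1 ++ written_arrs c2
  | While _ c1 => written_arrs c1
  | _ => [::]
  end.

Fixpoint emits (c : cmd) : bool :=
  match c with
  | Emit _ => true
  | Seq c1 c2 | If _ c1 c2 => emits c1 || emits c2
  | While _ c1 => emits c1
  | _ => false
  end.

(** What [c] cannot change, read off its syntax. Specifications need then mention only what a
    program computes. *)
Record frame (c : cmd) (s s' : state) : Prop := Frame {
  frame_reg : forall r, r \notin written_regs c -> regs s' r = regs s r;
  frame_arr : forall k j, k \notin written_arrs c -> arrs s' k j = arrs s k j;
  frame_out : ~~ emits c -> output s' = output s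
}.

Arguments frame_reg {c s s'} _ r _.
Arguments frame_arr {c s s'} _ k j _.

Lemma frame_refl c s : frame c s s.
Proof. by []. Qed.

Lemma frame_trans c s1 s2 s3 : frame c s1 s2 -> frame c s2 s3 -> frame c s1 s3.
Proof.
move=> [r1 a1 o1] [r2 a2 o2]; split=> [r h|k j h|h].
- by rewrite r2 // r1.
- by rewrite a2 // a1.
- by rewrite o2 // o1.
Qed.

Lemma frame_sub c c' s s' :
  {subset written_regs c <= written_regs c'} ->
  {subset written_arrs c <= written_arrs c'} ->
  (emits c -> emits c') -> frame c s s' -> frame c' s s'.
Proof.
move=> sr sa se [r a o]; split=> [i h|k j h|h].
- by apply: r; apply: contra h; apply: sr.
- by apply: a; apply: contra h; apply: sa.
- by apply: o; apply: contra h.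
Qed.

Lemma frame_catl c1 c2 s s' : frame c1 s s' -> frame (Seq c1 c2) s s'.
Proof.
apply: frame_sub => /= [r|k|] h; first by rewrite mem_cat h.
  by rewrite mem_cat h.
by rewrite h.
Qed.

Lemma frame_catr c1 c2 s s' : frame c2 s s' -> frame (Seq c1 c2) s s'.
Proof.
apply: frame_sub => /= [r|k|] h; first by rewrite mem_cat h orbT.
  by rewrite mem_cat h orbT.
by rewrite h orbT.
Qed.

Lemma exec_frame W c s t s' : exec W c s t s' -> frame c s s'.
Proof.
elim=> {c s t s'}.
- by [].
- move=> s i e; split=> //= r; rewrite inE => /negPf ri; by rewrite ri.
- move=> s k e1 e2; split=> //= k' j; rewrite inE => /negPf ->; by [].
- by move=> s e; split.
- move=> c1 c2 s s1 s2 t1 t2 _ f1 _ f2.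
  exact: frame_trans (frame_catl _ f1) (frame_catr _ f2).
- by move=> e c1 c2 s s1 t _ _ f; case: (frame_catl c2 f).
- by move=> e c1 c2 s s1 t _ _ f; case: (frame_catr c1 f).
- by [].
- by move=> e c s s1 s2 t1 t2 _ _ [r a o] _; apply: frame_trans.
Qed.

(** Total correctness with a time budget: only an upper bound [T] is tracked. *)
Definition runs (W : nat) (c : cmd) (s : state) (T : nat) (P : state -> Prop) : Prop
  :=
  exists t s', [/\ exec W c s t s', t <= T & P s'].

Lemma runs_leq W c s T T' P : runs W c s T P -> T <= T' -> runs W c s T' P.
Proof.
by move=> [t [s' [h tT p]]] TT; exists t, s'; split=> //; apply: leq_trans TT.
Qed.

Lemma runs_post W c s T (P P' : state -> Prop) : runs W c s T P ->
  (forall s', frame c s s' -> P s' -> P' s') -> runs W c s T P'.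
Proof.
move=> [t [s' [h tT p]]] PP; exists t, s'; split=> //.
by apply: PP => //; apply: exec_frame h.
Qed.

Lemma runs_skip W s (P : state -> Prop) : P s -> runs W Skip s 1 P.
Proof. by exists 1, s; split=> //; apply: ExecSkip. Qed.

Lemma runs_assign W i e s (P : state -> Prop) :
  P (set_reg s i (eval W s e)) -> runs W (Assign i e) s (cost e).+1 P.
Proof.
by exists (cost e).+1, (set_reg s i (eval W s e)); split=> //; apply: ExecAssign.
Qed.

Lemma runs_store W k e1 e2 s (P : state -> Prop) :
  P (set_arr s k (eval W s e1) (eval W s e2)) ->
  runs W (Store k e1 e2) s (cost e1 + cost e2).+1 P.
Proof. by move=> h; do 2 eexists; split; [apply: ExecStore| |]. Qed.

Lemma runs_emit W e s (P : state -> Prop) :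
  P (emit s (eval W s e)) -> runs W (Emit e) s (cost e).+1 P.
Proof. by move=> h; do 2 eexists; split; [apply: ExecEmit| |]. Qed.

Lemma runs_seq W c1 c2 s T1 T2 (P Q : state -> Prop) : runs W c1 s T1 Q ->
  (forall s1, frame c1 s s1 -> Q s1 -> runs W c2 s1 T2 P) ->
  runs W (Seq c1 c2) s (T1 + T2) P.
Proof.
move=> [t1 [s1 [h1 tT1 q]]] /(_ s1 (exec_frame h1) q) [t2 [s2 [h2 tT2 p]]].
exists (t1 + t2), s2; split=> //; first exact: ExecSeq h1 h2.
exact: leq_add.
Qed.

Lemma runs_seq_assign W i e c2 s T2 (P : state -> Prop) :
  runs W c2 (set_reg s i (eval W s e)) T2 P ->
  runs W (Seq (Assign i e) c2) s ((cost e).+1 + T2) P.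
Proof.
move=> h; apply: (@runs_seq _ _ _ _ _ _ _ (eq (set_reg s i (eval W s e)))).
  exact: runs_assign.
by move=> _ _ <-.
Qed.

Lemma runs_seq_store W k e1 e2 c2 s T2 (P : state -> Prop) :
  runs W c2 (set_arr s k (eval W s e1) (eval W s e2)) T2 P ->
  runs W (Seq (Store k e1 e2) c2) s ((cost e1 + cost e2).+1 + T2) P.
Proof.
move=> h; apply: (@runs_seq _ _ _ _ _ _ _ (eq (set_arr s k (eval W s e1) (eval W s
  e2)))).
  exact: runs_store.
by move=> _ _ <-.
Qed.

Lemma runs_if W e c1 c2 s T1 T2 (P : state -> Prop) :
  (eval W s e != 0 -> runs W c1 s T1 P) ->
  (eval W s e = 0 -> runs W c2 s T2 P) ->
  runs W (If e c1 c2) s ((cost e).+1 + maxn T1 T2) P.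
Proof.
move=> h1 h2; have [e0|e0] := eqVneq (eval W s e) 0.
  have [t [s' [h tT p]]] := h2 e0; exists ((cost e).+1 + t), s'; split=> //.
    exact: ExecIfFalse.
  by rewrite leq_add2l leq_max tT orbT.
have [t [s' [h tT p]]] := h1 e0; exists ((cost e).+1 + t), s'; split=> //.
  exact: ExecIfTrue.
by rewrite leq_add2l leq_max tT.
Qed.

(* [I n s]: the loop invariant holds in [s] and at most [n] iterations remain. *)
Lemma runs_while W e c T (I : nat -> state -> Prop) n s : I n s ->
  (forall n' s', frame c s s' -> I n' s' -> eval W s' e != 0 ->
     0 < n' /\ runs W c s' T (I n'.-1)) ->
  runs W (While e c) s (n * (T + cost e + 1) + (cost e).+1)
    (fun s' => (exists n', I n' s') /\ eval W s' e = 0).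
Proof.
elim: n s => [|n IH] s Is step; have [e0|e0] := eqVneq (eval W s e) 0.
- exists (cost e).+1, s; split; first exact: ExecWhileFalse.
    by rewrite leq_addl.
  by split=> //; exists 0.
- by have [] := step _ _ (frame_refl c s) Is e0.
- exists (cost e).+1, s; split; first exact: ExecWhileFalse.
    by rewrite leq_addl.
  by split=> //; exists n.+1.
have [_ [t1 [s1 [h1 tT1 I1]]]] := step _ _ (frame_refl c s) Is e0.
have fr1 := exec_frame h1.
have [t2 [s2 [h2 tT2 p]]] := IH s1 I1
  (fun n' s' fr => step n' s' (frame_trans fr1 fr)).
exists ((cost e).+1 + t1 + t2), s2; split=> //; first exact: ExecWhileTrue h1 h2.
rewrite mulSn; lia.
Qed.

Definition For (i : nat) (e : expr) (c : cmd) : cmd :=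
  Seq (Assign i (Cst 0))
    (While (Bin OpLt (Reg i) e)
      (Seq c (Assign i (Bin OpAdd (Reg i) (Cst 1))))).

(** The bound [e] is evaluated again at every test, so its value must stay [E]; [E < W] keeps the
    counter from wrapping around. *)
Lemma runs_for W i e c E T (I : nat -> state -> Prop) s :
  E < W -> 1 < W ->
  I 0 (set_reg s i 0) ->
  (forall n s', frame (For i e c) s s' -> I n s' -> eval W s' e = E) ->
  (forall n s', frame (For i e c) s s' -> n < E -> I n s' -> regs s' i = n ->
     runs W c s' T (fun s'' => regs s'' i = n /\ I n.+1 (set_reg s'' i n.+1))) ->
  runs W (For i e c) s (E.+1 * (T + cost e + 10)) (fun s' => I E s' /\ regs s' i = E).
Proof.
move=> EW W1 I0 eE step.
have fr0 : frame (For i e c) s (set_reg s i 0).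
  by split=> //= r; rewrite inE negb_or => /andP[/negPf ->].
apply: runs_leq; first apply: runs_seq_assign; last first.
  instantiate (1 := E * (T + 4 + (cost e).+2 + 1) + (cost e).+3).
  by rewrite /= mulSn; nia.
rewrite /= mod0n.
(* [runs_while] counts the remaining iterations, [I] the completed ones. *)
pose J n s' := [/\ frame (For i e c) s s', n <= E, regs s' i = E - n & I (E - n) s'].
apply: runs_post; first apply: (@runs_while _ _ _ (T + 4) J E).
- by split=> //=; rewrite ?subnn ?eqxx.
- move=> n s' _ [fr nE ri Is]; rewrite /= (eE _ _ fr Is) ri.
  have [lt _|//] := ltnP (E - n) E; have n0 : 0 < n by lia.
  split=> //; apply: runs_seq (step _ _ fr lt Is ri) _ => s1 f1 [r1 I1].
  apply: runs_assign; rewrite /= r1 (modn_small W1) addn1.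
  have e1 : (E - n).+1 = E - n.-1 by lia.
  rewrite modn_small; last by lia.
  split=> //=; rewrite ?eqxx -?e1 //; last by lia.
  apply: frame_trans fr _; split=> [r|k j|] /=.
  + rewrite inE !mem_cat !negb_or => /and3P[/negPf -> h _].
    exact: (frame_reg f1).
  + by rewrite cats0; apply: (frame_arr f1).
  + by rewrite orbF; apply: (frame_out f1).
- move=> s' _ [[n [fr nE ri Is]]]; rewrite /= (eE _ _ fr Is) ri => h.
  have e1 : E - n = E by move: h; case: ltnP => //; lia.
  by move: ri Is; rewrite e1.
Qed.

Ltac use_frame fr :=
  match type of fr with
  | frame ?c ?s ?s' =>
    repeat match goal with
    | |- context [regs s' ?r] => rewrite (frame_reg fr r isT)
    | |- context [arrs s' ?k ?j] => rewrite (frame_arr fr k j isT)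
    end
  end.

Ltac small_words W :=
  repeat match goal with
  | |- context [modn ?x W] =>
      rewrite (@modn_small x W); [|solve [assumption | lia]]
  end.

(** * The program *)

(* Registers: 0, 1, 2 hold [N], [a], [b] (capped at [N]); 3 holds the number of
   binary digits of [N], 4 [m = a b], 5 the degree [c], 7 the prime [Q], 9 [q],
   10 [n1], 11 [n2], 12 the number of base-[Q] digits of [N], 22 [n1 n2]; the
   others are scratch.  Arrays: 0 is the inner code, 1 the weights of pairs of
   words, 2 the bucket sums, 3 the odometer enumerating the rows, 4 the marks of
   the symbols sent to 1. *)

Definition count_digits (dst src : nat) (base : expr) : cmd :=
  Seq (Assign dst (Cst 0)) (Seq (Assign 6 (Reg src))
    (While (Reg 6)
      (Seq (Assign 6 (Bin OpDiv (Reg 6) base))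
           (Assign dst (Bin OpAdd (Reg dst) (Cst 1)))))).

(** Serves both the constant base 2 and the base held in register 7, whence an expression of cost 1
    with a stable value. *)
Lemma count_digits_spec W dst src base B n s :
  dst != 6 -> src != 6 -> src != dst -> cost base = 1 ->
  (forall s', frame (count_digits dst src base) s s' -> eval W s' base = B) ->
  regs s src = n -> 1 < B -> 0 < n -> (trunc_log B n).+1 < W ->
  runs W (count_digits dst src base) s (20 * (trunc_log B n).+2)
    (fun s' => regs s' dst = (trunc_log B n).+1).
Proof.
move=> d6 s6 sd cb baseE sn B1 n0 DW; set D := (trunc_log B n).+1.
have lt_D i : (n %/ B ^ i != 0) = (i < D).
  rewrite -lt0n divn_gt0 ?expn_gt0 ?(ltnW B1) // /D ltnS.
  apply/idP/idP => [|iD]; first exact: trunc_log_max.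
  apply: leq_trans (trunc_logP B1 n0).
  by rewrite leq_exp2l.
pose s2 := set_reg (set_reg s dst 0) 6 n.
have fr2 : frame (count_digits dst src base) s s2.
  split=> //= r; rewrite !inE !negb_or => /and4P[/negPf rd /negPf r6 _ _].
  by rewrite r6 rd.
apply: runs_leq.
  apply: runs_seq_assign; apply: runs_seq_assign.
  rewrite /= (negPf sd) sn mod0n -/s2.
  apply: runs_post.
    pose J k s' := frame (count_digits dst src base) s s' /\
      exists i, [/\ regs s' 6 = n %/ B ^ i, regs s' dst = i & k + i = D].
    apply: (@runs_while _ _ _ 8 J D).
      split=> //; exists 0; rewrite /= expn0 divn1 addn0; split=> //.
      by rewrite eqxx (negPf d6).
    move=> k s' _ [fr [i [r6 ri ki]]]; rewrite /= r6 lt_D => iD.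
    split; first by lia.
    apply: (@runs_leq _ _ _ ((cost (Bin OpDiv (Reg 6) base)).+1 + 4)).
      apply: runs_seq_assign; apply: runs_assign.
      rewrite /= (baseE _ fr) r6 (negPf d6) ri.
      small_words W.
      split.
        apply: frame_trans fr _; split=> //= r.
        rewrite !inE !negb_or => /and4P[_ _ /negPf r6' /negPf rd].
        by rewrite rd r6'.
      exists i.+1; split=> /=; rewrite ?eqxx; last by lia.
        by rewrite eq_sym (negPf d6) expnSr divnMA.
      by rewrite addn1.
    by rewrite /= cb.
  move=> s' _ [[k [_ [i [r6 ri ki]]]]] /= e; rewrite ri.
  have : ~~ (i < D) by rewrite -lt_D -r6 e.
  lia.
rewrite /=; nia.
Qed.

(** Subsets of ['I_N] have at most [N] elements, so capping loses nothing. *)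
Definition cap (i : nat) : cmd := If (Bin OpLt (Reg 0) (Reg i)) (Assign i (Reg 0))
  Skip.

Lemma cap_spec W i s :
  runs W (cap i) s 6 (fun s' => regs s' i = minn (regs s i) (regs s 0)).
Proof.
apply: runs_leq; first apply: runs_if => /=.
- case: ltnP => // h _; apply: runs_assign => /=; rewrite eqxx; lia.
- case: ltnP => // h _; apply: runs_skip; lia.
- by [].
Qed.

Definition root_degree : cmd :=
  Seq (Assign 5 (Cst 1)) (Seq (Assign 6 (Reg 1))
    (While (Bin OpMul (Bin OpLt (Reg 5) (Reg 3)) (Bin OpLt (Reg 6) (Reg 0)))
      (Seq (Assign 6 (Bin OpMul (Reg 6) (Reg 1)))
           (Assign 5 (Bin OpAdd (Reg 5) (Cst 1)))))).

(** The cap takes care of [a = 1], no power of which reaches a larger [N]. For [a >= 2], as many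
    factors as [N] has binary digits always suffice. *)
Definition capped_root (N a L c : nat) : Prop :=
  [/\ 0 < c <= L, forall c', 0 < c' -> N <= a ^ c' -> c <= c' & N <= a ^ c \/ c = L].

Lemma root_degree_spec W s N a L :
  regs s 0 = N -> regs s 1 = a -> regs s 3 = L ->
  0 < a <= N -> 0 < L -> L < W -> N * N < W -> 1 < W ->
  runs W root_degree s (30 * L) (fun s' => capped_root N a L (regs s' 5)).
Proof.
move=> sN sa sL /andP[a0 aN] L0 LW NW W1.
apply: runs_leq.
  apply: runs_seq_assign; apply: runs_seq_assign.
  rewrite /=. rewrite sa modn_small //.
  apply: runs_post.
    pose J k s' := [/\ frame root_degree s s', 0 < regs s' 5 <= L,
      regs s' 6 = a ^ regs s' 5,
      forall c', 0 < c' -> c' < regs s' 5 -> a ^ c' < N & k + regs s' 5 = L].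
    apply: (@runs_while _ _ _ 8 J L.-1).
      split=> //=; try lia.
      by split=> //= r; rewrite !inE !negb_or => /and4P[/negPf -> /negPf ->].
    move=> k s' _ [fr cL r6 lts kL].
    rewrite /=; use_frame fr; rewrite sN sL.
    case: ltnP => cltL; last by rewrite mul0n mod0n.
    case: ltnP => plt; last by rewrite mod0n.
    move=> _; split; first by lia.
    (* The last product may exceed [N], but both of its factors are at most [N]. *)
    have paW : regs s' 6 * a < W by apply: leq_ltn_trans NW; apply: leq_mul => //;
      lia.
    apply: runs_leq; first (apply: runs_seq_assign; apply: runs_assign).
      rewrite /=; use_frame fr; rewrite sa; small_words W.
      split=> //=; try lia.
      - apply: frame_trans fr _; split=> //= r.
        by rewrite !inE !negb_or => /and4P[_ _ /negPf -> /negPf ->].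
      - by rewrite r6 addn1 expnSr.
      - move=> c' c0; rewrite addn1 ltnS leq_eqVlt => /orP[/eqP ->|/(lts _ c0) //].
        by rewrite -r6.
    by [].
  move=> s' _ [[k [fr cL r6 lts kL]]].
  rewrite /=; use_frame fr; rewrite sN sL => e.
  split=> //.
    move=> c' c0 h; rewrite leqNgt; apply/negP => /(lts _ c0); lia.
  move: e; rewrite -r6; case: (ltnP (regs s' 6) N) => h; last by left.
  case: ltnP => h2; last by right; lia.
  by rewrite /= modn_small.
rewrite /=; nia.
Qed.

(** [c ^ b.+1] may not fit into a word, so the multiplication stops as soon as the power exceeds
    [m * L]. *)
Definition power_test : cmd :=
  Seq (Assign 8 (Bin OpAdd (Bin OpMul (Reg 4) (Reg 3)) (Cst 1)))
  (Seq (Assign 14 (Cst 0)) (Seq (Assign 6 (Reg 5))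
    (While (Bin OpMul (Bin OpLt (Reg 14) (Reg 2)) (Bin OpLt (Reg 6) (Reg 8)))
      (Seq (Assign 6 (Bin OpMul (Reg 6) (Reg 5)))
           (Assign 14 (Bin OpAdd (Reg 14) (Cst 1))))))).

Lemma power_test_spec W s b c m L :
  regs s 2 = b -> regs s 5 = c -> regs s 4 = m -> regs s 3 = L ->
  0 < c <= L -> b < W -> (m * L).+1 * L < W -> 1 < W ->
  runs W power_test s (30 * b.+1)
    (fun s' => (regs s' 6 < regs s' 8) = (c ^ b.+1 <= m * L)).
Proof.
move=> sb sc sm sL /andP[c0 cL] bW mLW W1.
have mLW1 : (m * L).+1 < W.
  by apply: leq_ltn_trans mLW; rewrite leq_pmulr //; lia.
apply: runs_leq.
  do 3 apply: runs_seq_assign.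
  rewrite /= sm sL sc; small_words W.
  apply: runs_post.
    pose J k s' := [/\ frame power_test s s', regs s' 8 = (m * L).+1,
      regs s' 6 = c ^ (regs s' 14).+1 & k + regs s' 14 = b].
    apply: (@runs_while _ _ _ 8 J b).
      split=> /=; rewrite ?addn1 ?addn0 ?expn1 //.
      split=> //= r; rewrite !inE !negb_or.
      by move=> /and5P[/negPf -> /negPf -> /negPf -> _ _].
    move=> k s' _ [fr r8 r6 kb].
    rewrite /=; use_frame fr; rewrite sb r8.
    case: ltnP => ltb; last by rewrite mul0n mod0n.
    case: ltnP => ltP; last by rewrite mod0n.
    move=> _; split; first by lia.
    have PcW : regs s' 6 * c < W.
      by apply: leq_ltn_trans mLW; apply: leq_mul => //; lia.
    apply: runs_leq; first (apply: runs_seq_assign; apply: runs_assign).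
      rewrite /=; use_frame fr; rewrite sc; small_words W.
      split=> //=; [| |by lia].
      - apply: frame_trans fr _; split=> //= r; rewrite !inE !negb_or.
        by move=> /and5P[_ /negPf -> /negPf -> _ _].
      - by rewrite r6 addn1 -expnSr.
    by [].
  move=> s' _ [[k [fr r8 r6 kb]]].
  rewrite /=; use_frame fr; rewrite sb r8 => e; rewrite ltnS.
  move: e; case: (ltnP (regs s' 14) b) => hb; last first.
    by move=> _; rewrite r6; have -> : regs s' 14 = b by lia.
  case: (ltnP (regs s' 6)) => h; first by rewrite /= modn_small.
  (* On an early exit a lower power of [c] already exceeds [m * L], hence so does [c ^ b.+1]. *)
  move=> _; rewrite leqNgt h; apply/esym/negbTE; rewrite -ltnNge.
  apply: leq_trans h _; rewrite r6 leq_pexp2l //; lia.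
rewrite /=; nia.
Qed.

Definition least_divisor : cmd :=
  Seq (Assign 8 (Cst 2))
    (While (Bin OpMod (Reg 7) (Reg 8)) (Assign 8 (Bin OpAdd (Reg 8) (Cst 1)))).

Lemma least_divisor_spec W s Q :
  regs s 7 = Q -> 1 < Q -> Q < W ->
  runs W least_divisor s (20 * Q) (fun s' => regs s' 8 = pdiv Q).
Proof.
move=> sQ Q1 QW.
have pQ : pdiv Q <= Q by apply: pdiv_leq; lia.
have p1 : 1 < pdiv Q by apply/prime_gt1/pdiv_prime.
apply: runs_leq.
  apply: runs_seq_assign; rewrite /= modn_small; last by lia.
  apply: runs_post.
    pose J k s' := [/\ frame least_divisor s s', 1 < regs s' 8 &
      k + regs s' 8 = pdiv Q].
    apply: (@runs_while _ _ _ 4 J (pdiv Q - 2)).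
      split=> //=; last by lia.
      by split=> //= r; rewrite !inE !negb_or => /andP[/negPf ->].
    move=> k s' _ [fr d1 kd]; rewrite /=; use_frame fr; rewrite sQ => nd.
    have : regs s' 8 != pdiv Q.
      by apply: contra nd => /eqP ->; apply: pdiv_dvd.
    move=> ne; split; first by lia.
    apply: runs_assign; rewrite /=; small_words W.
    split=> /=; [|lia|lia].
    apply: frame_trans fr _; split=> //= r.
    by rewrite !inE !negb_or => /andP[/negPf ->].
  move=> s' _ [[k [fr d1 kd]]]; rewrite /=; use_frame fr; rewrite sQ => e.
  have dv : regs s' 8 %| Q by rewrite /dvdn e.
  have := pdiv_min_dvd d1 dv; lia.
rewrite /=; nia.
Qed.

(** A candidate is prime when its least divisor is itself. The initial 0 in register 8 forces a
    first increment, so the prime found is strictly larger than the input. *)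
Definition next_prime : cmd :=
  Seq (Assign 8 (Cst 0))
    (While (Bin OpLt (Reg 8) (Reg 7))
      (Seq (Assign 7 (Bin OpAdd (Reg 7) (Cst 1))) least_divisor)).

Lemma next_prime_spec W s X p :
  regs s 7 = X -> 0 < X -> prime p -> X < p -> p < W ->
  runs W next_prime s (60 * (p * p))
    (fun s' => prime (regs s' 7) /\ X < regs s' 7 <= p).
Proof.
move=> sX X0 pp Xp pW; have p1 := prime_gt1 pp.
apply: runs_leq.
  apply: runs_seq_assign; rewrite /= mod0n.
  apply: runs_post.
    pose J k s' := [/\ 0 < regs s' 7 <= p, k + regs s' 7 = p, X <= regs s' 7,
      regs s' 8 < regs s' 7 -> regs s' 7 < p &
      regs s' 7 <= regs s' 8 -> prime (regs s' 7) /\ X < regs s' 7].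
    apply: (@runs_while _ _ _ (20 * p + 4) J (p - X)).
      rewrite /J /= sX; split=> //; lia.
    move=> k s' _ [Qp kQ XQ lt _]; rewrite /=; case: ltnP => // /lt {}lt _.
    split; first by lia.
    apply: (@runs_leq _ _ _ (4 + 20 * (regs s' 7).+1)); last by lia.
    apply: runs_seq_assign; rewrite /=; small_words W.
    rewrite addn1; apply: runs_post.
      apply: (@least_divisor_spec _ _ (regs s' 7).+1) => //; lia.
    move=> s1 f1 r8; rewrite /J r8; use_frame f1; rewrite /=.
    have pQ : pdiv (regs s' 7).+1 <= (regs s' 7).+1 by apply: pdiv_leq.
    split; try lia.
      move=> h; have : (regs s' 7).+1 != p; last by lia.
      by apply: contraTneq h => ->; rewrite pdiv_id // ltnn.
    move=> h; split; last by lia.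
    have -> : (regs s' 7).+1 = pdiv (regs s' 7).+1 by lia.
    by apply: pdiv_prime; lia.
  move=> s' _ [[k [Qp kQ XQ _ ex]]] /=; case: ltnP => // /ex[pQ XQ'] _.
  by split=> //; lia.
rewrite /=; nia.
Qed.

Lemma trunc_log_lt n : 0 < n -> trunc_log 2 n < n.
Proof.
by move=> n0; apply: leq_trans (ltn_expl _ _) (trunc_logP _ n0).
Qed.

Lemma leq_trunc_log_base Q n : 1 < Q -> 0 < n -> trunc_log Q n <= trunc_log 2 n.
Proof.
move=> Q1 n0; apply: trunc_log_max => //.
apply: leq_trans (trunc_logP Q1 n0).
by case: (trunc_log Q n) => // t; rewrite leq_exp2r.
Qed.

(* The two regimes: a bare Reed-Solomon code over [Q] symbols, or a
   Reed-Solomon code concatenated with [Q] words of length [n2] over [8 m]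
   symbols, agreeing in fewer than [5 log Q <= n2 / (2 m)] places. *)
Definition code_params (C N a b Q q n1 n2 : nat) : Prop :=
  let m := a * b in
  let L := (trunc_log 2 N).+1 in
  exists2 c, capped_root N a L c & prime Q /\
    ([/\ c ^ b.+1 <= m * L, m * c < Q <= C * (m * c), q = Q, n1 = Q & n2 = 1] \/
     [/\ m * L < c ^ b.+1, 2 * (m * L) < Q <= C * (2 * (m * L)), q = 8 * m,
         n1 = 2 * m * (trunc_log Q N).+1 & n2 = 16 * m * (trunc_log 2 Q).+1]).

Definition choose_modulus : cmd :=
  Seq (If (Reg 13)
         (Assign 7 (Bin OpMul (Reg 4) (Reg 5)))
         (Assign 7 (Bin OpMul (Cst 2) (Bin OpMul (Reg 4) (Reg 3)))))
      next_prime.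

Definition choose_lengths : cmd :=
  If (Reg 13)
    (Seq (Assign 9 (Reg 7)) (Seq (Assign 10 (Reg 7)) (Assign 11 (Cst 1))))
    (Seq (count_digits 16 7 (Cst 2))
    (Seq (Assign 9 (Bin OpMul (Cst 8) (Reg 4)))
    (Seq (Assign 10 (Bin OpMul (Bin OpMul (Cst 2) (Reg 4)) (Reg 12)))
         (Assign 11 (Bin OpMul (Bin OpMul (Cst 16) (Reg 4)) (Reg 16)))))).

Definition choose_params : cmd :=
  Seq (cap 1) (Seq (cap 2) (Seq (count_digits 3 0 (Cst 2))
  (Seq (Assign 4 (Bin OpMul (Reg 1) (Reg 2)))
  (Seq root_degree (Seq power_test
  (Seq (Assign 13 (Bin OpLt (Reg 6) (Reg 8)))
  (Seq choose_modulus
  (Seq (count_digits 12 0 (Reg 7))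
  (Seq choose_lengths
       (Assign 22 (Bin OpMul (Reg 10) (Reg 11)))))))))))).

Lemma choose_modulus_spec W C s m c L :
  (forall n, 0 < n -> exists2 p, prime p & n < p <= C * n) ->
  regs s 4 = m -> regs s 5 = c -> regs s 3 = L -> 0 < m -> 0 < c <= L ->
  let X := if regs s 13 == 0 then 2 * (m * L) else m * c in
  let Z := C * (2 * (m * L)) in
  Z < W -> 2 * (m * L) < W -> 2 < W ->
  runs W choose_modulus s (60 * (Z * Z) + 10)
    (fun s' => prime (regs s' 7) /\ X < regs s' 7 <= C * X).
Proof.
move=> bert sm sc sL m0 /andP[c0 cL] X Z ZW mLW W2.
have X0 : 0 < X by rewrite /X; case: ifP; nia.
have XZ : C * X <= Z by rewrite /Z /X; case: ifP => _ //; nia.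
have [p pp /andP[Xp pC]] := bert X X0.
have s7 : runs W (If (Reg 13) (Assign 7 (Bin OpMul (Reg 4) (Reg 5)))
    (Assign 7 (Bin OpMul (Cst 2) (Bin OpMul (Reg 4) (Reg 3))))) s 8
    (fun s' => regs s' 7 = X).
  apply: runs_leq; first apply: runs_if => /= [e|e].
  - apply: runs_assign; rewrite /= sm sc /X (negPf e) modn_small //; nia.
  - apply: runs_assign; rewrite /= sm sL /X e eqxx; small_words W; by [].
  by [].
apply: runs_leq; first apply: runs_seq s7 _ => s1 _ r7.
  apply: runs_post; first apply: (@next_prime_spec _ _ X p) => //; first by lia.
  move=> s' _ [pr /andP[lt le]]; split=> //; rewrite lt; exact: leq_trans le pC.
by rewrite addnC; apply: leq_add => //; rewrite leq_mul2l; nia.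
Qed.

Lemma choose_params_spec W C s N a0 b0 :
  (forall n, 0 < n -> exists2 p, prime p & n < p <= C * n) ->
  regs s 0 = N -> regs s 1 = a0 -> regs s 2 = b0 ->
  0 < N -> 0 < b0 <= a0 ->
  let a := minn a0 N in let b := minn b0 N in
  let L := (trunc_log 2 N).+1 in
  let m := a * b in let Z := C * (2 * (m * L)) in
  N * N < W -> 16 * m * (Z * Z) < W ->
  runs W choose_params s (200 * (N + Z * Z))
    (fun s' => [/\ regs s' 2 = b, regs s' 12 = (trunc_log (regs s' 7) N).+1,
      regs s' 22 = regs s' 10 * regs s' 11 &
      code_params C N a b (regs s' 7) (regs s' 9) (regs s' 10) (regs s' 11)]).
Proof.
move=> bert sN sa sb N0 /andP[b00 ba] a b L m Z NW ZW.
have C2 : 1 < C by have [p _ /andP[]] := bert 1 isT; lia.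
have a1 : 0 < a <= N by rewrite /a; lia.
have b1 : 0 < b <= N by rewrite /b; lia.
have m1 : 0 < m by rewrite /m; nia.
have mN : m <= N * N by rewrite /m; nia.
have LN : L <= N by rewrite /L; apply: trunc_log_lt.
have L1 : 0 < L by [].
have mL : 0 < m * L by rewrite muln_gt0 m1.
have Z4 : 4 * (m * L) <= Z by rewrite /Z; nia.
have ZZ : Z <= Z * Z by nia.
have ZZm : 16 * (Z * Z) <= 16 * m * (Z * Z) by rewrite -mulnA leq_mul2l leq_pmull.
have W1 : 16 < W by nia.
have mW : m < W by lia.
have LmL : L <= m * L by rewrite leq_pmull.
have LZ : 4 * L <= Z by apply: leq_trans Z4; rewrite leq_mul2l.
have NN : N <= N * N by rewrite leq_pmull.
have LZ1 : L <= Z by lia.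
have mLZ : (m * L).+1 <= Z by lia.
have mLL : (m * L).+1 * L < W.
  by apply: leq_ltn_trans (leq_mul mLZ LZ1) _; lia.
have Z16 : 16 * m * Z <= 16 * m * (Z * Z) by rewrite leq_mul2l leq_pmull ?orbT //;
  lia.
apply: runs_leq.
  apply: (runs_seq (cap_spec _ _ _)) => s1 f1 s1a.
  apply: (runs_seq (cap_spec _ _ _)) => s2 f2 s2b.
  have r0 : regs s2 0 = N by use_frame f2; use_frame f1.
  have r1 : regs s2 1 = a by use_frame f2; rewrite s1a sN sa.
  have r2 : regs s2 2 = b by rewrite s2b; use_frame f1; rewrite sN sb.
  apply: (runs_seq (@count_digits_spec _ _ _ _ 2 N _ _ _ _ _ _ _ _ _ _)) => //.
  - by move=> s' _; rewrite /= modn_small; lia.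
  - by rewrite -/L; lia.
  rewrite -/L => s3 f3 r3; apply: runs_seq_assign.
  rewrite /=; use_frame f3; rewrite r1 r2 (modn_small (m:=a * b)) // -/m.
  set s4 := set_reg _ _ _.
  apply: (runs_seq (@root_degree_spec _ s4 N a L _ _ _ _ _ _ _ _)) => //=.
  - by use_frame f3.
  - by use_frame f3.
  - by lia.
  - by lia.
  move=> s5 f5 root; have cL : 0 < regs s5 5 <= L by case: root.
  apply: (runs_seq (@power_test_spec _ s5 b (regs s5 5) m L _ _ _ _ _ _ _ _)) => //=.
  - by use_frame f5; rewrite /=; use_frame f3.
  - by use_frame f5.
  - by use_frame f5.
  - by lia.
  - by lia.
  move=> s6 f6 test; apply: runs_seq_assign; rewrite /= test.
  set flag := _ <= _; set s7 := set_reg _ _ _.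
  apply: (runs_seq (@choose_modulus_spec _ C s7 m (regs s5 5) L bert _ _ _ _ _ _ _
    _)) => //=.
  - by use_frame f6; use_frame f5.
  - by use_frame f6.
  - by use_frame f6; use_frame f5.
  - by lia.
  - by lia.
  - by lia.
  move=> s8 f8 [Qp Qb]; have Q1 := prime_gt1 Qp.
  have QZ : regs s8 7 <= Z.
    case/andP: Qb => _ h; apply: leq_trans h _; rewrite /Z.
    rewrite leq_mul2l; apply/orP; right; case: ifP => _ //.
    apply: (@leq_trans (m * L)); last by rewrite leq_pmull.
    by rewrite leq_mul2l; case/andP: cL => _ ->; rewrite orbT.
  have kL : (trunc_log (regs s8 7) N).+1 <= L by rewrite ltnS leq_trunc_log_base.
  have dig : runs W (count_digits 12 0 (Reg 7)) s8 (20 * L.+1)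
      (fun s' => regs s' 12 = (trunc_log (regs s8 7) N).+1).
    apply: runs_leq; first apply: (@count_digits_spec _ _ _ _ (regs s8 7) N) => //=.
    - by move=> s' fr; use_frame fr.
    - by use_frame f8; rewrite /=; use_frame f6; use_frame f5; rewrite /=;
      use_frame f3.
    - by lia.
    by rewrite leq_mul2l.
  apply: (runs_seq dig) => s9 f9 r12.
  have QE : regs s9 7 = regs s8 7 by use_frame f9.
  have LQ : (trunc_log 2 (regs s8 7)).+1 <= regs s8 7 by apply: trunc_log_lt; lia.
  have flagE : regs s9 13 = flag by use_frame f9; use_frame f8; rewrite /=.
  have mE : regs s9 4 = m by use_frame f9; use_frame f8; rewrite /=; use_frame f6;
    use_frame f5.
  have len : runs W choose_lengths s9 (20 * Z + 60) (fun s' =>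
      code_params C N a b (regs s9 7) (regs s' 9) (regs s' 10) (regs s' 11) /\
      regs s' 10 * regs s' 11 < W).
    apply: runs_leq; first apply: runs_if => /= [e|e].
    - do 2 apply: runs_seq_assign; apply: runs_assign => /=.
      rewrite modn_small; last by lia.
      split; last by rewrite muln1 QE; lia.
      exists (regs s5 5) => //; rewrite QE; split=> //; left.
      rewrite flagE in e; move: Qb; rewrite (negPf e) => Qb; split=> //.
      by move: e; rewrite /flag; case: (_ <= _).
    - apply: (runs_seq (@count_digits_spec _ _ _ _ 2 (regs s9 7) _ _ _ _ _ _ _ _ _
      _)) => //=.
      + by move=> s' _; rewrite modn_small; lia.
      + by rewrite QE; lia.
      + by rewrite QE; lia.
      move=> s10 f10 r16; do 2 apply: runs_seq_assign; apply: runs_assign => /=.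
      use_frame f10; rewrite r16 r12 mE QE.
      set LL := (trunc_log 2 _).+1 in LQ *; set kk := (trunc_log _ N).+1 in kL *.
      have h1 : 2 * m * kk <= Z.
        by apply: leq_trans Z4; rewrite -mulnA; apply: leq_mul => //;
          rewrite leq_mul2l kL orbT.
      have h2 : 16 * m * LL <= 16 * m * Z by rewrite leq_mul2l (leq_trans LQ QZ) orbT.
      have h3 : 2 * m * kk * (16 * m * LL) <= 16 * m * (Z * Z).
        by rewrite [leqRHS]mulnCA; apply: leq_mul.
      have h4 : 16 * m <= 16 * m * Z by rewrite leq_pmulr //; lia.
      have h5 : 2 * m <= 2 * m * kk by rewrite leq_pmulr.
      rewrite -/LL -/kk; small_words W.
      split; last by lia.
      exists (regs s5 5) => //; split=> //; right.
      rewrite flagE in e; move: Qb; rewrite e eqxx => Qb; split=> //.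
      by move: e; rewrite /flag ltnNge; case: (_ <= _).
    rewrite /= QE; lia.
  apply: (runs_seq len) => s10 f10 [par RW]; apply: runs_assign => /=.
  rewrite modn_small //; split=> //.
  - by use_frame f10; use_frame f9; use_frame f8; rewrite /=; use_frame f6;
    use_frame f5; rewrite /=; use_frame f3.
  - by use_frame f10; rewrite r12 QE.
  - by use_frame f10.
rewrite /=.
have h5 : (trunc_log 2 N).+2 <= 2 * N by rewrite /L in LN; lia.
lia.
Qed.

(** * Computing the inner code *)

Lemma ltn_flatten_index n m i j : i < n -> j < m -> i * m + j < n * m.
Proof.
move=> iN jm; apply: (@leq_trans (i.+1 * m)); first by rewrite mulSn; lia.
by rewrite leq_mul2r iN orbT.
Qed.

Lemma flatten_index_inj m i j i' j' : j < m -> j' < m ->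
  (i * m + j == i' * m + j') = (i == i') && (j == j').
Proof.
move=> jm jm'; have m0 : 0 < m by lia.
apply/eqP/andP => [e|[/eqP -> /eqP ->] //]; split; apply/eqP.
  have := congr1 (divn ^~ m) e.
  by rewrite /= !divnMDl // (divn_small jm) (divn_small jm') !addn0.
have := congr1 (modn ^~ m) e.
by rewrite /= !modnMDl (modn_small jm) (modn_small jm').
Qed.

Definition tab (s : state) (n2 x j : nat) : nat := arrs s 0 (x * n2 + j).

Definition symbol_expr (x : nat) : expr :=
  Arr 0 (Bin OpAdd (Bin OpMul (Reg x) (Reg 11)) (Reg 14)).

Definition pair_expr : expr := Bin OpAdd (Bin OpMul (Reg 15) (Reg 7)) (Reg 16).

Definition clear_buckets : cmd := For 16 (Reg 9) (Store 2 (Reg 16) (Cst 0)).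

Lemma clear_buckets_spec W s q : regs s 9 = q -> q < W -> 1 < W ->
  runs W clear_buckets s (20 * q.+1) (fun s' => forall v, v < q -> arrs s' 2 v = 0).
Proof.
move=> sq qW W1; apply: runs_leq.
  apply: runs_post.
    apply: (@runs_for _ _ _ _ q 3 (fun n s' => forall v, v < n -> arrs s' 2 v = 0))
      => //.
    - by move=> n s' fr _; rewrite /=; use_frame fr.
    move=> n s' fr nq h r16; apply: runs_leq; first apply: runs_store.
      rewrite /= mod0n r16; split=> // v /=.
      by rewrite ltnS leq_eqVlt; case: eqVneq => //= _ /h.
    by [].
  by move=> s' _ [].
rewrite /=; lia.
Qed.

Definition fill_buckets : cmd :=
  For 16 (Reg 15)
    (Store 2 (symbol_expr 16)
       (Bin OpAdd (Arr 2 (symbol_expr 16)) (Bin OpAdd (Arr 1 pair_expr) (Cst 1)))).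

Lemma fill_buckets_spec W s Q q n2 x j :
  regs s 7 = Q -> regs s 11 = n2 -> regs s 15 = x -> regs s 14 = j ->
  x < Q -> j < n2 -> Q * n2 < W -> Q * Q < W ->
  (forall y, y < x -> tab s n2 y j < q) ->
  (forall v, v < q -> arrs s 2 v = 0) ->
  \sum_(y < x) (arrs s 1 (x * Q + y)).+1 < W -> 1 < W ->
  runs W fill_buckets s (60 * x.+1) (fun s' => forall v, v < q ->
    arrs s' 2 v = \sum_(y < x) (tab s n2 y j == v) * (arrs s 1 (x * Q + y)).+1).
Proof.
move=> sQ sn sx sj xQ jn QnW QQW Tq S0 sumW W1; apply: runs_leq.
  apply: runs_post.
    apply: (@runs_for _ _ _ _ x 23 (fun n s' => forall v, v < q ->
        arrs s' 2 v = \sum_(y < n) (tab s n2 y j == v) * (arrs s 1 (x * Q + y)).+1))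
          => //.
    - have QQ : Q <= Q * Q by rewrite leq_pmull //; lia.
      lia.
    - by move=> v /S0 h; rewrite big_ord0.
    - by move=> n s' fr _; rewrite /=; use_frame fr.
    move=> n s' fr nx h r16; apply: runs_leq; first apply: runs_store.
      rewrite /=; use_frame fr; rewrite r16 sQ sn sx sj.
      have i1 : n * n2 + j < Q * n2 by apply: ltn_flatten_index => //; lia.
      have i2 : x * Q + n < Q * Q by apply: ltn_flatten_index => //; lia.
      have i3 : n * n2 <= n * n2 + j by lia.
      have i4 : x * Q <= x * Q + n by lia.
      small_words W.
      have le : arrs s' 2 (tab s n2 n j) + (arrs s 1 (x * Q + n)).+1 < W.
        apply: leq_ltn_trans sumW; rewrite (h _ (Tq _ nx)).
        rewrite -(subnKC nx) big_split_ord /= big_ord_recr /=.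
        apply: leq_trans (leq_addr _ _); rewrite leq_add2r.
        by apply: leq_sum => y _; case: eqP => _; rewrite ?mul1n ?mul0n.
      rewrite -/(tab s n2 n j) in le *.
      rewrite !addn1; small_words W.
      split=> // v vq /=; rewrite big_ord_recr /=.
      case: eqVneq => [->|ne]; first by rewrite mul1n h ?Tq.
      by rewrite mul0n addn0 h.
    by [].
  by move=> s' _ [].
rewrite /=; lia.
Qed.

Definition argmin_bucket : cmd :=
  Seq (Assign 17 (Cst 0))
    (For 16 (Reg 9)
      (If (Bin OpLt (Arr 2 (Reg 16)) (Arr 2 (Reg 17))) (Assign 17 (Reg 16)) Skip)).

Lemma argmin_bucket_spec W s q : regs s 9 = q -> 0 < q -> q < W -> 1 < W ->
  runs W argmin_bucket s (40 * q.+1) (fun s' => regs s' 17 < q /\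
    forall v, v < q -> arrs s 2 (regs s' 17) <= arrs s 2 v).
Proof.
move=> sq q0 qW W1; apply: runs_leq.
  apply: runs_seq_assign; rewrite /= mod0n; apply: runs_post.
    apply: (@runs_for _ _ _ _ q 10 (fun n s' => regs s' 17 < q /\
      forall v, v < n -> arrs s 2 (regs s' 17) <= arrs s 2 v)) => //.
    - by move=> n s' fr _; rewrite /=; use_frame fr.
    move=> n s' fr nq [bq h] r16; apply: runs_leq; first apply: runs_if => /=.
    - use_frame fr; rewrite /= r16; case: ltnP => // lt _; apply: runs_assign.
      rewrite /= r16; split=> //; split=> // v.
      rewrite ltnS leq_eqVlt => /orP[/eqP -> //|/h].
      exact: leq_trans (ltnW lt).
    - use_frame fr; rewrite /= r16; case: ltnP => // le _; apply: runs_skip.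
      rewrite /= r16; split=> //; split=> // v.
      by rewrite ltnS leq_eqVlt => /orP[/eqP -> //|/h].
    by [].
  by move=> s' _ [].
rewrite /=; lia.
Qed.

(** Weights are stored minus one, so doubling one sends [w] to [2 * w + 1]. *)
Definition update_weights : cmd :=
  For 16 (Reg 15)
    (If (Bin OpEq (symbol_expr 16) (Reg 17))
       (Store 1 pair_expr (Bin OpAdd (Bin OpMul (Cst 2) (Arr 1 pair_expr)) (Cst 1)))
       Skip).

Lemma update_weights_spec W s Q n2 x j :
  regs s 7 = Q -> regs s 11 = n2 -> regs s 15 = x -> regs s 14 = j ->
  x < Q -> j < n2 -> Q * n2 < W -> Q * Q < W ->
  (forall y, y < x -> 2 * (arrs s 1 (x * Q + y)).+1 < W) -> 2 < W ->
  runs W update_weights s (60 * x.+1) (fun s' =>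
    (forall y, y < x -> (arrs s' 1 (x * Q + y)).+1 =
       2 ^ (tab s n2 y j == regs s 17) * (arrs s 1 (x * Q + y)).+1) /\
    (forall i, i < x * Q \/ x * Q + x <= i -> arrs s' 1 i = arrs s 1 i)).
Proof.
move=> sQ sn sx sj xQ jn QnW QQW w2W W2; apply: runs_leq.
  apply: runs_post.
    apply: (@runs_for _ _ _ _ x 30 (fun n s' =>
      (forall y, y < n -> (arrs s' 1 (x * Q + y)).+1 =
       2 ^ (tab s n2 y j == regs s 17) * (arrs s 1 (x * Q + y)).+1) /\
      (forall i, i < x * Q \/ x * Q + n <= i -> arrs s' 1 i = arrs s 1 i))) => //.
    - have QQ : Q <= Q * Q by rewrite leq_pmull //; lia.
      lia.
    - by lia.
    - by move=> n s' fr _; rewrite /=; use_frame fr.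
    move=> n s' fr nx [h1 h2] r16.
    have i1 : n * n2 + j < Q * n2 by apply: ltn_flatten_index => //; lia.
    have i2 : x * Q + n < Q * Q by apply: ltn_flatten_index => //; lia.
    have i3 : n * n2 <= n * n2 + j by lia.
    have i4 : x * Q <= x * Q + n by lia.
    have e : arrs s' 1 (x * Q + n) = arrs s 1 (x * Q + n) by apply: h2; right.
    have w2 := w2W n nx.
    apply: runs_leq; first apply: runs_if => /=.
    - use_frame fr; rewrite /= r16 sn sj; small_words W; rewrite -/(tab s n2 n j).
      case: (eqVneq (tab s n2 n j) (regs s 17)) => // tb _; apply: runs_store;
        rewrite /=; use_frame fr.
      rewrite /= r16 sQ sx; small_words W; rewrite e; small_words W.
      split=> //; split=> [y|i] /=.
        rewrite ltnS leq_eqVlt; case: eqVneq => [-> _|ne /= yn].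
          by rewrite !eqxx tb eqxx expn1; lia.
        by rewrite eqn_add2l (negPf ne) h1.
      case: eqVneq => [->|_ hi]; first by lia.
      by apply: h2; lia.
    - use_frame fr; rewrite /= r16 sn sj; small_words W; rewrite -/(tab s n2 n j).
      case: (eqVneq (tab s n2 n j) (regs s 17)) => // tb _; apply: runs_skip;
        split=> //; split=> [y|i] /=.
        rewrite ltnS leq_eqVlt; case: eqVneq => [-> _|ne /= yn]; last exact: h1.
        by rewrite e (negPf tb) mul1n.
      by move=> hi; apply: h2; lia.
    by [].
  by move=> s' _ [].
rewrite /=; lia.
Qed.

Lemma eq_agree T T' j x y : (forall i, i < j -> T x i = T' x i) ->
  (forall i, i < j -> T y i = T' y i) -> agree T j x y = agree T' j x y.
Proof. by move=> ex ey; apply: eq_bigr => i _; rewrite ex ?ey. Qed.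

(** Greediness at [(x, j)] only looks at words up to [x] and columns up to [j], so later stores
    preserve it. *)
Lemma eq_greedy q T T' x j :
  (forall y i, y <= x -> i <= j -> T y i = T' y i) ->
  greedy q T x j -> greedy q T' x j.
Proof.
move=> e [Tq le]; split; first by rewrite -e.
have ag (y : 'I_x) : agree T j x y = agree T' j x y.
  by apply: eq_agree => i ij; apply: e => //; apply: ltnW.
rewrite /weight -(eq_bigr _ (fun y _ => congr1 (expn 2) (ag y))).
apply: leq_trans le; rewrite leq_mul2l; apply/orP; right.
by apply: leq_sum => y _; rewrite ag !e // ltnW.
Qed.

(* Words [x' < x] carry their symbol of rank [j]; entry [x' * Q + y] of array 1
   holds the weight of the pair minus one, so that zero arrays are valid. *)
Definition code_inv (Q q n2 j x : nat) (s : state) : Prop :=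
  (forall x' i, x' < Q -> i < n2 -> i < j \/ (i = j /\ x' < x) ->
     greedy q (tab s n2) x' i) /\
  (forall x' y, y < x' -> x' < Q ->
     (arrs s 1 (x' * Q + y)).+1 = 2 ^ agree (tab s n2) (j + (x' < x)) x' y).

Definition word_symbol : cmd :=
  Seq clear_buckets (Seq fill_buckets (Seq argmin_bucket
  (Seq (Store 0 (Bin OpAdd (Bin OpMul (Reg 15) (Reg 11)) (Reg 14)) (Reg 17))
       update_weights))).

(** The least of [q] buckets is at most their average, and the buckets together carry the weight of
    word [x]; this is the greedy condition. [B] bounds that weight so that all sums fit into a
    word. *)
Lemma word_symbol_spec W s Q q n2 x j B :
  regs s 7 = Q -> regs s 9 = q -> regs s 11 = n2 -> regs s 15 = x -> regs s 14 = j ->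
  x < Q -> 0 < q -> q < W -> j < n2 -> Q * n2 < W -> Q * Q < W -> 2 < W ->
  q.+1 ^ j * Q <= B * q ^ j -> 2 * B < W ->
  code_inv Q q n2 j x s ->
  runs W word_symbol s (200 * (Q + q).+1) (code_inv Q q n2 j x.+1).
Proof.
move=> sQ sq sn sx sj xQ q0 qW jn QnW QQW W2 HB BW [gr wt].
have wB : weight (tab s n2) j x <= B.
  have := @weight_leq q (tab s n2) j x (fun i ij => gr x i xQ (ltn_trans ij jn)
    (or_introl ij)).
  have qj : 0 < q ^ j by rewrite expn_gt0 q0.
  move=> h; rewrite -(leq_pmul2l qj); apply: leq_trans h _.
  rewrite [leqRHS]mulnC; apply: leq_trans HB.
  by rewrite leq_mul2l (ltnW xQ) orbT.
have wx y : y < x -> (arrs s 1 (x * Q + y)).+1 = 2 ^ agree (tab s n2) j x y.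
  by move=> yx; rewrite wt // ltnn addn0.
apply: runs_leq.
  apply: (runs_seq (@clear_buckets_spec _ _ q _ _ _)) => //; first by lia.
  move=> s1 f1 S1.
  have t1 y i : tab s1 n2 y i = tab s n2 y i by rewrite /tab; use_frame f1.
  apply: (runs_seq (@fill_buckets_spec _ _ Q q n2 x j _ _ _ _ _ _ _ _ _ _ _ _)) => //.
  - by use_frame f1.
  - by use_frame f1.
  - by use_frame f1.
  - by use_frame f1.
  - by move=> y yx; rewrite t1;
    have [] := gr y j (ltn_trans yx xQ) jn (or_intror (conj erefl yx)).
  - apply: (@leq_ltn_trans B); last by lia.
    apply: leq_trans wB; apply: leq_sum => y _; use_frame f1; by rewrite wx.
  - by lia.
  move=> s2 f2 S2.
  apply: (runs_seq (@argmin_bucket_spec _ _ q _ _ _ _)) => //.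
  - by use_frame f2; use_frame f1.
  - by lia.
  move=> s3 f3 [bq mn]; set v := regs s3 17 in bq mn *.
  apply: runs_seq_store; rewrite /= -/v; use_frame f3; use_frame f2; use_frame f1.
  rewrite sx sn sj.
  have i1 : x * n2 + j < Q * n2 by apply: ltn_flatten_index.
  have i3 : x * n2 <= x * n2 + j by lia.
  small_words W; set s4 := set_arr _ _ _ _.
  have tE y i : i < n2 -> tab s4 n2 y i = if (y == x) && (i == j) then v else tab s
    n2 y i.
    move=> ilt; rewrite /tab /= flatten_index_inj //; case: ifP => // _.
    by use_frame f3; use_frame f2; use_frame f1.
  have wE i : arrs s4 1 i = arrs s 1 i.
    by rewrite /=; use_frame f3; use_frame f2; use_frame f1.
  apply: runs_post; first apply: (@update_weights_spec _ _ Q n2 x j) => //=.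
  - by use_frame f3; use_frame f2; use_frame f1.
  - by use_frame f3; use_frame f2; use_frame f1.
  - by use_frame f3; use_frame f2; use_frame f1.
  - by use_frame f3; use_frame f2; use_frame f1.
  - move=> y yx; use_frame f3; use_frame f2; use_frame f1.
    rewrite wx //; apply: leq_ltn_trans BW; rewrite leq_mul2l /=.
    by apply: leq_trans wB; apply: exp2_agree_weight.
  move=> s5 f5 [u1 u2].
  have t5 y i : i < n2 -> tab s5 n2 y i = if (y == x) && (i == j) then v else tab s
    n2 y i.
    by move=> ilt; rewrite /tab; use_frame f5; exact: tE.
  have t5' y i : i < n2 -> (y == x) && (i == j) = false -> tab s5 n2 y i = tab s n2 y
    i.
    by move=> ilt e; rewrite t5 // e.
  have ag5 y z : z < y -> y < x \/ x < y -> agree (tab s5 n2) (j + (y < x.+1)) y z =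
      agree (tab s n2) (j + (y < x)) y z.
    move=> zy yx; have -> : (y < x.+1) = (y < x) by rewrite ltnS leq_eqVlt; lia.
    apply: eq_agree => i ij; apply: t5'; lia.
  have ag5x y : y < x -> agree (tab s5 n2) j x y = agree (tab s n2) j x y.
    by move=> yx; apply: eq_agree => i ij; apply: t5'; lia.
  split=> [x' i x'Q ilt|x' y yx' x'Q].
    have [[-> ->] _|ne] := (eqVneq (x', i) (x, j)).
      split; first by rewrite t5 // !eqxx.
      have -> : weight (tab s5 n2) j x = weight (tab s n2) j x.
        by apply: eq_bigr => y _; rewrite ag5x.
      rewrite (eq_bigr (fun y : 'I_x => (tab s n2 y j == v) * 2 ^ agree (tab s n2) j
        x y)); last first.
        move=> y _; rewrite ag5x // [tab s5 n2 x j]t5 // !eqxx t5' //.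
        by have := ltn_ord y; lia.
      have S2E u : u < q -> arrs s2 2 u =
          \sum_(y < x) (tab s n2 y j == u) * 2 ^ agree (tab s n2) j x y.
        move=> uq; rewrite S2 //; apply: eq_bigr => y _.
        by use_frame f1; rewrite t1 wx.
      rewrite -S2E //.
      (* [q] times the minimum is at most the sum of the buckets, and each earlier word lies in
         exactly one of them. *)
      apply: (@leq_trans (\sum_(u < q) arrs s2 2 u)).
        by rewrite -{1}(card_ord q) -sum_nat_const; apply: leq_sum => u _; apply: mn.
      rewrite (eq_bigr _ (fun u _ => S2E _ (ltn_ord u))) exchange_big /=.
      apply: leq_sum => y _.
      have Ty : tab s n2 y j < q.
        have yx := ltn_ord y.
        by have [] := gr y j (ltn_trans yx xQ) jn (or_intror (conj erefl yx)).
      rewrite (bigD1 (Ordinal Ty)) //= eqxx mul1n big1 ?addn0 // => u ne.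
      suff -> : (tab s n2 y j == u) = false by [].
      by apply/negbTE; rewrite eq_sym; exact: ne.
    rewrite xpair_eqE in ne => h.
    apply: (@eq_greedy _ (tab s n2)); last by apply: gr => //; lia.
    by move=> y i' yx' i'i; rewrite t5' //; lia.
  have [x'_x|ne] := eqVneq x' x; last first.
    (* The weights of another word lie outside the interval [[x * Q, x * Q + x)] that was
       rewritten. *)
    rewrite ag5; [|by []|lia]; rewrite -wt // -wE u2 //.
    have h1 : x' < x -> x' * Q + y < x * Q.
      by move=> lt; apply: ltn_flatten_index => //; lia.
    have h2 : x < x' -> x.+1 * Q <= x' * Q by move=> lt; rewrite leq_mul2r lt orbT.
    rewrite mulSn in h2; have := leqnn x; have [lt|lt] : x' < x \/ x < x' by lia.
      by left; apply: h1.
    by right; have := h2 lt; lia.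
  rewrite x'_x in yx' *; rewrite u1 // wE wx // tE // (ltn_eqF yx').
  rewrite (_ : regs s4 17 = v) // ltnS leqnn addn1 /agree big_ord_recr.
  rewrite -/(agree (tab s5 n2) j x y) -/(agree (tab s n2) j x y) ag5x // expnD mulnC.
  rewrite [tab s5 n2 x j]t5 // [tab s5 n2 y j]t5 // !eqxx (ltn_eqF yx').
  by rewrite [v == _]eq_sym.
rewrite /=; lia.
Qed.

Definition build_code : cmd := For 14 (Reg 11) (For 15 (Reg 7) word_symbol).

Lemma build_code_spec W s Q q n2 B :
  regs s 7 = Q -> regs s 9 = q -> regs s 11 = n2 ->
  0 < Q -> 0 < q -> q < W -> 0 < n2 -> Q * n2 < W -> Q * Q < W -> 2 < W ->
  (forall j, j < n2 -> q.+1 ^ j * Q <= B * q ^ j) -> 2 * B < W ->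
  (forall i, arrs s 1 i = 0) ->
  runs W build_code s (1000 * (n2.+1 * (Q.+1 * (Q + q).+1)))
    (fun s' => forall x i, x < Q -> i < n2 -> greedy q (tab s' n2) x i).
Proof.
move=> sQ sq sn Q0 q0 qW n20 QnW QQW W2 HB BW s1.
have QW : Q < W by apply: leq_ltn_trans QQW; rewrite leq_pmull.
have nW : n2 < W by apply: leq_ltn_trans QnW; rewrite leq_pmull.
apply: runs_leq.
  apply: runs_post.
    apply: (@runs_for _ _ _ _ n2 (Q.+1 * (200 * (Q + q).+1 + 1 + 10))
      (fun j s' => code_inv Q q n2 j 0 s')) => //; first by lia.
    - split=> [x' i _ _ [//|[] //]|x' y _ _].
      by rewrite /= s1 (_ : agree _ _ _ _ = 0) //; apply: big_ord0.
    - by move=> n s' fr _; rewrite /=; use_frame fr.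
    move=> j s' fr jn I r14; apply: runs_post.
      apply: (@runs_for _ _ _ _ Q (200 * (Q + q).+1)
        (fun x s'' => code_inv Q q n2 j x s'')) => //; first by lia.
      - by move=> x s'' fr' _; rewrite /=; use_frame fr'; use_frame fr.
      move=> x s'' fr' xQ I' r15; apply: runs_post.
        apply: (@word_symbol_spec _ _ Q q n2 x j B) => //; try exact: HB;
          by use_frame fr'; use_frame fr.
      by move=> s3 f3 I3; split=> //; use_frame f3.
    move=> s'' fr' [[g w] _]; split; first by use_frame fr'.
    (* Column [j] completed for all [Q] words is column [j.+1] with no word treated. *)
    split=> [x' i x'Q ilt [ij|[] //]|x' y yx x'Q].
      by apply: g => //; move: ij; rewrite ltnS leq_eqVlt => /orP[/eqP|];
        [right|left].
    by have := w _ _ yx x'Q; rewrite x'Q addn1 ltn0 addn0.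
  move=> s' _ [[g _] _] x i xQ ilt; apply: g => //; by left.
rewrite /=; nia.
Qed.

(** * Enumerating and writing the rows *)

Lemma iotaSr n : iota 0 n.+1 = iota 0 n ++ [:: n].
Proof. by rewrite -addn1 iotaD add0n. Qed.

(** Run with 1 before a row and with 0 after it: erasing the marks takes [O(b)] steps, whereas
    clearing all [q] of them could exceed the time allowed for a row. *)
Definition mark_digits (c : nat) : cmd :=
  For 14 (Reg 2) (Store 4 (Arr 3 (Reg 14)) (Cst c)).

Lemma mark_digits_spec W c s b : regs s 2 = b -> b < W -> c < W -> 1 < W ->
  runs W (mark_digits c) s (20 * b.+1) (fun s' => forall v,
    arrs s' 4 v = if v \in [seq arrs s 3 t | t <- iota 0 b] then c else arrs s 4 v).
Proof.
move=> sb bW cW W1; apply: runs_leq.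
  apply: runs_post.
    apply: (@runs_for _ _ _ _ b 4 (fun n s' => forall v,
      arrs s' 4 v = if v \in [seq arrs s 3 t | t <- iota 0 n] then c else arrs s 4
        v)) => //.
    - by move=> n s' fr _; rewrite /=; use_frame fr.
    move=> n s' fr nb h r14; apply: runs_leq; first apply: runs_store.
      rewrite iotaSr /=; use_frame fr; rewrite r14 modn_small //; split=> // v.
      rewrite map_cat mem_cat /= inE h.
      by case: eqVneq => _; rewrite ?orbT ?orbF.
    by [].
  by move=> s' _ [].
rewrite /=; lia.
Qed.

Definition eval_word : cmd :=
  Seq (Assign 17 (Reg 15)) (Seq (Assign 18 (Cst 0)) (Seq (Assign 19 (Cst 1))
    (For 16 (Reg 12)
      (Seq (Assign 18 (Bin OpMod
              (Bin OpAdd (Reg 18) (Bin OpMul (Bin OpMod (Reg 17) (Reg 7)) (Reg 19)))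
              (Reg 7)))
      (Seq (Assign 19 (Bin OpMod (Bin OpMul (Reg 19) (Reg 20)) (Reg 7)))
           (Assign 17 (Bin OpDiv (Reg 17) (Reg 7)))))))).

Lemma eval_word_spec W s Q k x e :
  regs s 7 = Q -> regs s 12 = k -> regs s 15 = x -> regs s 20 = e ->
  1 < Q -> e < Q -> Q * Q + Q < W -> k < W ->
  runs W eval_word s (60 * k.+1) (fun s' => regs s' 18 = rs_eval Q k x e).
Proof.
move=> sQ sk sx se Q1 eQ QQW kW; apply: runs_leq.
  do 3 apply: runs_seq_assign; rewrite /= mod0n modn_small; last by nia.
  apply: runs_post.
    apply: (@runs_for _ _ _ _ k 25 (fun t s' => [/\ regs s' 17 = x %/ Q ^ t,
      regs s' 18 = rs_eval Q t x e & regs s' 19 = e ^ t %% Q])) => //.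
    - by nia.
    - by rewrite /= /rs_eval big_ord0 mod0n expn0 divn1 modn_small.
    - by move=> n s' fr _; rewrite /=; use_frame fr.
    move=> t s' fr tk [r17 r18 r19] r16; apply: runs_leq.
      do 2 apply: runs_seq_assign; apply: runs_assign.
      rewrite /=; use_frame fr; rewrite /= sQ se r17 r18 r19.
      have h1 : x %/ Q ^ t %% Q < Q by rewrite ltn_mod; lia.
      have h2 : e ^ t %% Q < Q by rewrite ltn_mod; lia.
      have h3 : rs_eval Q t x e < Q by rewrite ltn_mod; lia.
      have h4 : x %/ Q ^ t %% Q * (e ^ t %% Q) <= Q * Q by apply: leq_mul; lia.
      have h5 : e ^ t %% Q * e <= Q * Q by apply: leq_mul; lia.
      small_words W; split=> //; split.
      - by rewrite expnSr divnMA.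
      - by rewrite /rs_eval big_ord_recr /= modnDml -modnDmr modnMmr modnDmr.
      - by rewrite modnMml expnSr.
    by [].
  by move=> s' _ [[]].
rewrite /=; lia.
Qed.

Definition emit_row : cmd :=
  Seq (Assign 20 (Bin OpDiv (Arr 3 (Reg 2)) (Reg 11)))
  (Seq (Assign 21 (Bin OpMod (Arr 3 (Reg 2)) (Reg 11)))
    (For 15 (Reg 0)
      (Seq eval_word
        (Emit (Arr 4 (Arr 0 (Bin OpAdd (Bin OpMul (Reg 18) (Reg 11)) (Reg 21)))))))).

Lemma emit_row_spec W s N b Q k n1 n2 r :
  regs s 0 = N -> regs s 2 = b -> regs s 7 = Q -> regs s 12 = k -> regs s 11 = n2 ->
  arrs s 3 b = r -> r < n1 * n2 -> n1 <= Q -> 0 < n2 ->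
  N < W -> 1 < Q -> Q * Q + Q < W -> Q * n2 < W -> k < W ->
  runs W emit_row s (200 * (N.+1 * k.+1)) (fun s' =>
    output s' = output s ++
      [seq arrs s 4 (code_symbol Q k n2 (tab s n2) x r) | x <- iota 0 N]).
Proof.
move=> sN sb sQ sk sn sr rR nQ n20 NW Q1 QQW QnW kW; apply: runs_leq.
  do 2 apply: runs_seq_assign; rewrite /= sb sn sr.
  apply: runs_post.
    apply: (@runs_for _ _ _ _ N (60 * k.+1 + 8) (fun n s' => output s' = output s ++
      [seq arrs s 4 (code_symbol Q k n2 (tab s n2) x r) | x <- iota 0 n])) => //.
    - by nia.
    - by rewrite /= cats0.
    - by move=> n s' fr _; rewrite /=; use_frame fr.
    move=> x s' fr xN out r15; apply: runs_leq.
      apply: (runs_seq (@eval_word_spec _ _ Q k x (r %/ n2) _ _ _ _ _ _ _ _)) => //;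
        try by use_frame fr.
      - by rewrite ltn_divLR //; apply: leq_trans rR _; rewrite leq_mul2r nQ orbT.
      move=> s1 f1 r18; apply: runs_emit; rewrite iotaSr /=.
      use_frame f1; use_frame fr; rewrite /= r18 sn.
      have i1 : rs_eval Q k x (r %/ n2) * n2 + r %% n2 < Q * n2.
        by apply: ltn_flatten_index; [rewrite /rs_eval ltn_mod; lia|rewrite ltn_mod].
      set u := rs_eval _ _ _ _ in i1 *; small_words W.
      rewrite r15; split=> //.
      rewrite (frame_out f1) // out map_cat /=.
      by rewrite -cats1 catA.
    by [].
  by move=> s' _ [].
rewrite /=; lia.
Qed.

(** Represents a row index too large for a word. Cell [b] is not reduced modulo [q]: it holds the
    coordinate of the code. *)
Definition odometer (q b i : nat) (s : state) : Prop :=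
  (forall t, t < b -> arrs s 3 t = i %/ q ^ t %% q) /\ arrs s 3 b = i %/ q ^ b.

Definition odometer_incr : cmd :=
  Seq (Assign 14 (Cst 0))
  (Seq (While (Bin OpMul (Bin OpLt (Reg 14) (Reg 2))
                 (Bin OpEq (Arr 3 (Reg 14)) (Bin OpSub (Reg 9) (Cst 1))))
         (Seq (Store 3 (Reg 14) (Cst 0)) (Assign 14 (Bin OpAdd (Reg 14) (Cst 1)))))
    (Store 3 (Reg 14) (Bin OpAdd (Arr 3 (Reg 14)) (Cst 1)))).

Lemma divnS_no_carry q u j : u %% q != q.-1 -> 0 < q -> u.+1 %/ q ^ j.+1 = u %/ q ^
  j.+1.
Proof.
move=> h q0; rewrite expnS !divnMA; congr (_ %/ _).
have lt := ltn_pmod u q0.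
rewrite {1}(divn_eq u q) -addnS divnMDl // (@divn_small (u %% q).+1) ?addn0 //; lia.
Qed.

Lemma odometer_incr_spec W s q b i :
  regs s 2 = b -> regs s 9 = q -> 1 < q -> q < W -> b < W ->
  odometer q b i s -> (i %/ q ^ b).+1 < W ->
  runs W odometer_incr s (60 * b.+1) (odometer q b i.+1).
Proof.
move=> sb sq q1 qW bW [dg db] iW; apply: runs_leq.
  apply: runs_seq_assign; rewrite /= mod0n.
  (* Register 14 is the position of the carry: all lower digits were [q.-1], that is, this power of
     [q] divides [i.+1]. *)
  pose J k s' := [/\ frame odometer_incr s s', k + regs s' 14 = b,
    q ^ regs s' 14 %| i.+1, forall t, t < regs s' 14 -> arrs s' 3 t = 0 &
    forall t, regs s' 14 <= t -> arrs s' 3 t = arrs s 3 t].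
  apply: (@runs_seq _ _ _ _ _ _ _ (fun s' => (exists k, J k s') /\
      (regs s' 14 = b \/ arrs s' 3 (regs s' 14) <> q.-1))).
    apply: runs_post.
      apply: (@runs_while _ _ _ 7 J b).
        split=> //=; rewrite ?addn0 ?expn0 ?dvd1n //.
        by split=> //= r; rewrite !inE !negb_or => /andP[/negPf ->].
      move=> k s' _ [fr kb dv z nz]; rewrite /=; use_frame fr; rewrite sb sq.
      case: ltnP => ltb; last by rewrite mul0n mod0n.
      rewrite (modn_small (m := 1)); last by lia.
      rewrite nz // dg //.
      case: (eqVneq (i %/ q ^ regs s' 14 %% q) (q - 1)) => e;
        last by rewrite muln0 mod0n.
      move=> _; split; first by lia.
      apply: runs_leq; first (apply: runs_seq_store; apply: runs_assign).
        rewrite /= mod0n; small_words W.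
        split=> /=; [|by lia| | |].
        - apply: frame_trans fr _; split=> //= [r|k' j].
            by rewrite !inE !negb_or => /andP[/negPf -> _].
          by rewrite !inE !negb_or => /andP[/negPf -> _].
        - rewrite addn1 expnSr; case/dvdnP: dv => u iu.
          (* With [i.+1] equal to [u] times the power of [q], the digit of [i] at the carry position
             is [u.-1 %% q]. *)
          have iE : i = u.-1 * q ^ regs s' 14 + (q ^ regs s' 14).-1.
            have q0 : 0 < q ^ regs s' 14 by rewrite expn_gt0; lia.
            by case: u iu => [|u]; rewrite ?mulSn; lia.
          have q0 : 0 < q ^ regs s' 14 by rewrite expn_gt0; lia.
          rewrite {1}iE divnMDl // divn_small ?addn0 in e; last by lia.
          rewrite iu mulnC dvdn_pmul2r //.
          case: u {iu iE} e => [|u] /= e; first by rewrite dvdn0.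
          by rewrite /dvdn -addn1 -modnDml e subnK ?modnn //; lia.
        - move=> t; rewrite addn1 ltnS leq_eqVlt; case: eqVneq => //= _ lt.
          exact: z.
        - move=> t; rewrite addn1 => lt; rewrite gtn_eqF //; apply: nz.
          exact: ltnW.
      by [].
    move=> s' _ [[k Jk]]; have [fr kb dv z nz] := Jk.
    rewrite /=; use_frame fr; rewrite sb sq => h; split; first by exists k.
    move: h; case: ltnP => ltb; last by left; lia.
    rewrite (modn_small (m := 1)); last by lia.
    case: eqP => [_|ne]; first by rewrite muln1 modn_small //; lia.
    by right; move: ne; rewrite subn1.
  move=> s1 _ [[k [fr kb dv z nz]] stop]; apply: runs_store.
  set t0 := regs s1 14 in kb dv z nz stop *.
  have t0b : t0 <= b by lia.
  have q0 : 0 < q ^ t0 by rewrite expn_gt0; lia.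
  case/dvdnP: dv => u iu.
  have u0 : 0 < u by case: u iu => //; rewrite mul0n.
  have it0 : i %/ q ^ t0 = u.-1.
    have -> : i = u.-1 * q ^ t0 + (q ^ t0).-1 by case: u iu u0 => // u;
      rewrite mulSn; lia.
    by rewrite divnMDl // divn_small ?addn0 //; lia.
  have it0' : i.+1 %/ q ^ t0 = u by rewrite iu mulnK.
  (* The digit at the stopping position differs from [q.-1] and absorbs the carry. *)
  have hi t : t0 < t -> t0 < b -> i.+1 %/ q ^ t = i %/ q ^ t.
    move=> tt tb; case: stop => [|ne]; first by lia.
    rewrite nz // dg // it0 in ne.
    rewrite -(subnKC tt) addSnnS expnD !divnMA it0 it0' -{1}(prednK u0).
    by apply: divnS_no_carry; [apply/eqP|lia].
  have lo t : t < t0 -> i.+1 %/ q ^ t %% q = 0.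
    move=> tt; rewrite iu -(subnKC (ltnW tt)) expnD mulnCA mulKn ?expn_gt0;
      last by lia.
    have -> : t0 - t = (t0 - t.+1).+1 by lia.
    by rewrite expnSr mulnA modnMl.
  have dgW t : t <= b -> arrs s 3 t + 1 < W.
    rewrite leq_eqVlt => /orP[/eqP ->|tb]; first by rewrite db addn1.
    by rewrite dg //; have := ltn_pmod (i %/ q ^ t) (ltnW q1); lia.
  have sW := dgW t0 t0b.
  rewrite /= -/t0 nz //; small_words W.
  split=> [t tb|] /=.
    case: eqVneq => [tt|ne].
      rewrite {t}tt in tb *.
      rewrite dg // it0 it0'; case: stop => [|ne]; first by lia.
      rewrite nz // dg // it0 in ne.
      have lt := ltn_pmod u.-1 (ltnW q1).
      have -> : u %% q = (u.-1 %% q + 1) %% q by rewrite modnDml addn1 prednK.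
      by rewrite (@modn_small (u.-1 %% q + 1)) //; lia.
    have [lt|le] := ltnP t t0; first by rewrite z // lo.
    have lt : t0 < t by lia.
    by rewrite nz // dg // hi //; lia.
  case: eqVneq => [bt|ne]; first by rewrite bt it0' -bt db bt it0 addn1 prednK.
  have lt : t0 < b by lia.
  by rewrite nz // db hi.
rewrite /=; lia.
Qed.

Definition output_rows : cmd :=
  While (Bin OpLt (Arr 3 (Reg 2)) (Reg 22))
    (Seq (mark_digits 1) (Seq emit_row (Seq (mark_digits 0) odometer_incr))).

Lemma output_rows_spec W s N b Q q k n1 n2 :
  regs s 0 = N -> regs s 2 = b -> regs s 7 = Q -> regs s 9 = q ->
  regs s 11 = n2 -> regs s 12 = k -> regs s 22 = n1 * n2 ->
  (forall t, arrs s 3 t = 0) -> (forall v, arrs s 4 v = 0) -> output s = [::] ->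
  b <= N -> 1 < q -> q < W -> n1 <= Q -> 0 < n2 -> N < W -> 1 < Q ->
  Q * Q + Q < W -> Q * n2 < W -> k < W ->
  runs W output_rows s ((n1 * n2 * q ^ b).+1 * (500 * (N.+1 * k.+1)))
    (fun s' => output s' =
      [seq (code_hash q b (code_symbol Q k n2 (tab s n2)) i x : nat)
         | i <- iota 0 (n1 * n2 * q ^ b), x <- iota 0 N]).
Proof.
move=> sN sb sQ sq sn sk sR D0 M0 out0 bN q1 qW nQ n20 NW Q1 QQW QnW kW.
set l := n1 * n2 * q ^ b; set sym := code_symbol _ _ _ _.
have RW : n1 * n2 < W by apply: leq_ltn_trans QnW; rewrite leq_mul2r nQ orbT.
have qb0 : 0 < q ^ b by rewrite expn_gt0; lia.
have W1 : 1 < W by lia.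
have NK : N.+1 <= N.+1 * k.+1 by rewrite leq_pmulr.
pose J n s' := exists2 i, n + i = l & [/\ odometer q b i s',
  forall v, arrs s' 4 v = 0 &
  output s' = [seq (code_hash q b sym i x : nat) | i <- iota 0 i, x <- iota 0 N]].
apply: runs_leq.
  apply: runs_post.
    apply: (@runs_while _ _ _ (400 * (N.+1 * k.+1)) J l).
      exists 0; first by rewrite addn0.
      by split=> //; split=> [t _|]; rewrite D0 ?div0n ?mod0n.
    move=> n s' fr [i ni [odo m0 out]].
    rewrite /= ; use_frame fr; rewrite sb sR odo.2 ltn_divLR // -/l => il.
    have {}il : i < l by move: il; case: ltnP.
    have rR : i %/ q ^ b < n1 * n2 by rewrite ltn_divLR.
    split; first by lia.
    have bW : b < W by lia.
    apply: (@runs_leq _ _ _ (20 * b.+1 + (200 * (N.+1 * k.+1) + (20 * b.+1 + 60 *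
      b.+1)))); last by lia.
    apply: (runs_seq (@mark_digits_spec _ _ _ b _ _ _ _)) => //;
      first by use_frame fr.
    move=> s1 f1 m1.
    apply: (runs_seq (@emit_row_spec _ _ N b Q k n1 n2 (i %/ q ^ b) _ _ _ _ _ _ _ _ _
      _ _ _ _ _)) => //;
      try by use_frame f1; use_frame fr.
      by use_frame f1; case: odo.
    move=> s2 f2 o2.
    apply: (runs_seq (@mark_digits_spec _ _ _ b _ _ _ _)) => //; try lia.
      by use_frame f2; use_frame f1; use_frame fr.
    move=> s3 f3 m3.
    apply: runs_post; first apply: (@odometer_incr_spec _ _ q b i) => //.
    - by use_frame f3; use_frame f2; use_frame f1; use_frame fr.
    - by use_frame f3; use_frame f2; use_frame f1; use_frame fr.
    - split=> [t tb|]; use_frame f3; use_frame f2; use_frame f1.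
        by rewrite odo.1.
      by rewrite odo.2.
    - by lia.
    move=> s4 f4 odo4; exists i.+1; first by lia.
    have dig t : t < b -> arrs s2 3 t = i %/ q ^ t %% q.
      by move=> tb; use_frame f2; use_frame f1; rewrite odo.1.
    have digE s0 v : (forall t, t < b -> arrs s0 3 t = i %/ q ^ t %% q) ->
        (v \in [seq arrs s0 3 t | t <- iota 0 b]) = in_digits q b i v.
      move=> h; rewrite /in_digits; congr (v \in _); apply/eq_in_map => t.
      by rewrite mem_iota add0n; apply: h.
    split=> //.
    - move=> v; use_frame f4; rewrite m3 digE; last by move=> t tb; apply: dig.
      case: ifP => // nd; use_frame f2; rewrite m1 digE ?nd //; exact: odo.1.
    rewrite (frame_out f4) // (frame_out f3) // o2 (frame_out f1) // out.
    rewrite iotaSr allpairs_cat; congr (_ ++ _).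
    rewrite /= cats0; apply: eq_map => x; rewrite m1 digE; last exact: odo.1.
    rewrite m0 /code_hash;
      have -> : forall y r, code_symbol Q k n2 (tab s1 n2) y r = sym y r.
      by move=> y r; rewrite /sym /code_symbol /tab; use_frame f1; use_frame fr.
    by case: in_digits.
  move=> s' fr [[n [i ni [odo _ out]]]].
  rewrite /=; use_frame fr; rewrite sb sR odo.2 ltn_divLR // -/l => e.
  by have <- : i = l by move: e; case: ltnP => //; lia.
rewrite /=; nia.
Qed.

(** * Parameters of the code *)

Lemma code_params_modulus C N a b Q q n1 n2 : 0 < N -> 0 < a -> 0 < b -> 0 < C ->
  code_params C N a b Q q n1 n2 ->
  Q <= C * (2 * (a * b * (trunc_log 2 N).+1)).
Proof.
move=> N0 a0 b0 C0 [c [/andP[c0 cL] _ _] [Qp [[_ /andP[_ QC] _ _ _]|[_ /andP[_ QC] _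
  _ _]]]] //.
apply: leq_trans QC _; rewrite leq_mul2l; apply/orP; right.
apply: (@leq_trans (a * b * (trunc_log 2 N).+1)); last by rewrite leq_pmull.
by rewrite leq_mul2l cL orbT.
Qed.

Lemma code_params_range C N a b Q q n1 n2 : 0 < N -> 0 < a -> 0 < b -> 0 < C ->
  code_params C N a b Q q n1 n2 ->
  let m := a * b in let Z := C * (2 * (m * (trunc_log 2 N).+1)) in
  [/\ 1 < Q, 1 < q, 0 < n1 <= Q, 0 < n2 <= 16 * m * Z & q <= 8 * Q].
Proof.
move=> N0 a0 b0 C0 par m Z; have QZ := code_params_modulus N0 a0 b0 C0 par.
rewrite -/m -/Z in QZ.
have m0 : 0 < m by rewrite muln_gt0 a0.
case: par => c _ [Qp par]; have Q1 := prime_gt1 Qp; move: par; rewrite -/m.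
set L := (trunc_log 2 N).+1 in Z QZ *.
case=> [[_ _ -> -> ->]|[_ /andP[XQ _] -> -> ->]].
  split=> //; [lia|nia|lia].
have kL : (trunc_log Q N).+1 <= L by rewrite ltnS leq_trunc_log_base.
have LQ : (trunc_log 2 Q).+1 <= Q by apply: trunc_log_lt; lia.
have h1 : 2 * m * (trunc_log Q N).+1 <= 2 * (m * L).
  by rewrite -mulnA leq_mul2l leq_mul2l kL orbT.
have mL : m <= m * L by rewrite leq_pmulr.
have mk : 0 < 2 * m * (trunc_log Q N).+1 by rewrite muln_gt0 muln_gt0 m0.
have ml : 0 < 16 * m * (trunc_log 2 Q).+1 by rewrite muln_gt0 muln_gt0 m0.
split=> //; [lia|lia| |lia].
by rewrite ml leq_mul2l (leq_trans LQ QZ) orbT.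
Qed.

(** Keeps the weights polynomial in [Q]. With [q = 8 m], every [4 m] columns at most double a
    weight, and [n2] columns form [4 * (trunc_log 2 Q).+1] such batches; the last factor [Q] bounds
    the initial weight. *)
Lemma code_params_weight C N a b Q q n1 n2 : 0 < a -> 0 < b ->
  code_params C N a b Q q n1 n2 ->
  forall j, j < n2 -> q.+1 ^ j * Q <= (2 * Q) ^ 4 * Q * q ^ j.
Proof.
move=> a0 b0 [c _ [Qp par]] j; have Q1 := prime_gt1 Qp.
have Q2 : 0 < (2 * Q) ^ 4 by rewrite expn_gt0; apply/orP; left; lia.
case: par => [[_ _ _ _ ->]|[_ _ -> _ ->]] jn.
  by have -> : j = 0 by [lia]; rewrite !expn0 mul1n muln1 leq_pmull.
set m := a * b in jn *; have m0 : 0 < m by rewrite muln_gt0 a0.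
set t := trunc_log 2 Q in jn *.
have h : (8 * m).+1 ^ j <= 2 ^ (4 * t.+1) * (8 * m) ^ j.
  apply: (@expnS_leq_exp2 _ (4 * m)); [lia|lia|nia].
apply: (@leq_trans (2 ^ (4 * t.+1) * (8 * m) ^ j * Q));
  first by rewrite leq_mul2r h orbT.
rewrite mulnAC leq_mul2r; apply/orP; right; rewrite leq_mul2r; apply/orP; right.
rewrite mulnC expnM leq_expn2r // expnS leq_mul2l /=.
by apply: trunc_logP => //; lia.
Qed.

(** If [N <= a ^ c], then [a < Q] gives [N < Q ^ c]. If [c] is capped, already [2 ^ c] exceeds
    [N]. *)
Lemma capped_root_rs_degree N a b Q c : 0 < a -> 0 < b -> 1 < Q ->
  capped_root N a (trunc_log 2 N).+1 c -> a * b * c < Q -> trunc_log Q N < c.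
Proof.
move=> a0 b0 Q1 [/andP[c0 cL] _ ac] mc.
rewrite ltnNge; apply/negP => ct.
have [N0|N0] := posnP N.
  by move: ct; rewrite N0 trunc_log0; lia.
have QcN : Q ^ c <= N by apply: leq_trans (trunc_logP Q1 N0); rewrite leq_exp2l.
case: ac => [Na|cE].
  have aQ : a < Q by apply: leq_ltn_trans mc; rewrite -mulnA leq_pmulr // muln_gt0 b0.
  have : a ^ c < Q ^ c by rewrite ltn_exp2r.
  lia.
have := trunc_log_ltn N (isT : 1 < 2); rewrite -cE.
have : 2 ^ c <= Q ^ c by rewrite leq_expn2r.
lia.
Qed.

Lemma code_params_agree C N a b Q q n1 n2 T : 0 < N -> 0 < a -> 0 < b -> 0 < C ->
  code_params C N a b Q q n1 n2 ->
  (forall x i, x < Q -> i < n2 -> greedy q T x i) ->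
  forall x y, x < N -> y < N -> x != y ->
  a * b * (\sum_(i < n1 * n2) (code_symbol Q (trunc_log Q N).+1 n2 T x i ==
     code_symbol Q (trunc_log Q N).+1 n2 T y i)) < n1 * n2.
Proof.
move=> N0 a0 b0 C0 par g x y xN yN xy.
have [Q1 q1 /andP[n10 nQ] /andP[n20 _] _] := code_params_range N0 a0 b0 C0 par.
have NQ := trunc_log_ltn N Q1.
set m := a * b; have m0 : 0 < m by rewrite muln_gt0 a0.
have sym (P : nat -> nat -> Prop) : (forall u v, P u v -> P v u) ->
    (forall u v, v < u -> u < Q -> P u v) ->
    forall u v, u < Q -> v < Q -> u != v -> P u v.
  move=> Ps Plt u v uQ vQ; case: ltngtP => // lt _; last exact: Plt.
  by apply: Ps; apply: Plt.
case: par => c cr [Qp par].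
case: par => [[_ /andP[XQ _] qQ nE1 nE2]|[_ /andP[XQ _] qE nE1 nE2]].
  (* One greedy column over [q = Q] symbols is injective: [Q] times the number of earlier words
     clashing with [u] is at most [u], which is below [Q]. *)
  apply: (@concat_code_agree Q _ n1 n2 0 _ _ N) => //; first exact: ltnW.
    apply: sym => [u v|u v vu uQ]; first by rewrite agreeC.
    have [_] := g u 0 uQ n20.
    have -> : weight T 0 u = u.
      by rewrite -[RHS]sum1_ord; apply: eq_bigr => z _; rewrite /agree big_ord0.
    rewrite (bigD1 (Ordinal vu)) //= /agree nE2 big_ord1 big_ord0 muln1 eq_sym.
    by case: eqP => // _; rewrite qQ; nia.
  rewrite muln0 addn0 nE1 nE2 !muln1 /=.
  have := capped_root_rs_degree a0 b0 Q1 cr XQ.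
  by rewrite -/m in XQ *; move=> h; apply: leq_ltn_trans XQ;
    rewrite leq_mul2l ltnW ?orbT.
set t := (trunc_log 2 Q).+1 in nE2.
have qE' : q = 8 * m by [].
(* Of the exponent [5 * t], the part [4 * t] pays for the growth of the weight over [n2] columns and
   [t] for its initial value [u < 2 ^ t]. *)
apply: (@concat_code_agree Q _ n1 n2 (5 * t) _ _ N) => //; first exact: ltnW.
  apply: sym => [u v|u v vu uQ]; first by rewrite agreeC.
  apply: ltnW; apply: (@agree_lt q _ _ _ u) => //; first by lia.
    by move=> i; apply: g.
  have h : q.+1 ^ n2 <= 2 ^ (4 * t) * q ^ n2.
    by apply: (@expnS_leq_exp2 _ (4 * m)); rewrite ?qE' ?nE2 -/m; [lia|lia|nia].
  have uT : u < 2 ^ t by apply: ltn_trans uQ (trunc_log_ltn _ _).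
  have -> : 2 ^ (5 * t) = 2 ^ (4 * t) * 2 ^ t by rewrite -expnD; congr (_ ^ _); lia.
  rewrite mulnAC; apply: (@leq_ltn_trans (2 ^ (4 * t) * q ^ n2 * u)).
    by rewrite leq_mul2r h orbT.
  by rewrite ltn_pmul2l // muln_gt0 !expn_gt0 /=; lia.
(* In units of [m * m * t], outer agreements cost [16 k] and inner ones [10 (k + 1)], against the
   length [32 (k + 1)]. *)
rewrite nE1 nE2 -/m /= mulSn.
have mt : 0 < m * t by rewrite muln_gt0 m0.
set k := trunc_log Q N; rewrite !mulnDr.
have -> : m * (k * (16 * m * t)) = 16 * (m * (m * t) * k) by lia.
have e2 : m * (2 * m * k.+1 * (5 * t)) = 10 * (m * (m * t) * k) + 10 * (m * (m * t))
  by lia.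
have e3 : 2 * m * k.+1 * (16 * m * t) = 32 * (m * (m * t) * k) + 32 * (m * (m * t))
  by lia.
have : 0 < m * (m * t) by rewrite muln_gt0 m0.
lia.
Qed.

(** Before rounding, the product of the two logarithms is [log2 N]. Rounding up adds both factors
    once, and [log2 Q] is [O(log N)] because [a], [b] and the digit count of [N] are all at most
    [N]. *)
Lemma digits_product C N a b Q : 0 < N -> 0 < a <= N -> 0 < b <= N -> 0 < C -> 1 < Q
  ->
  Q <= C * (2 * (a * b * (trunc_log 2 N).+1)) ->
  (trunc_log Q N).+1 * (trunc_log 2 Q).+1 <= (C + 7) * (trunc_log 2 N).+1.
Proof.
move=> N0 /andP[a0 aN] /andP[b0 bN] C0 Q1 QZ; set t := trunc_log 2 N in QZ *.
have Nt : N < 2 ^ t.+1 by apply: trunc_log_ltn.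
have Q0 : 0 < Q by lia.
have l1 : trunc_log Q N * trunc_log 2 Q < t.+1.
  rewrite -(@ltn_exp2l 2) // mulnC expnM; apply: leq_ltn_trans Nt.
  apply: leq_trans (trunc_logP Q1 N0); apply: leq_expn2r.
  exact: trunc_logP.
have l2 : trunc_log Q N <= t by apply: leq_trunc_log_base.
have l3 : trunc_log 2 Q < C + 1 + 3 * t.+1.
  rewrite -(@ltn_exp2l 2) //; apply: leq_ltn_trans (trunc_logP _ Q0) _ => //.
  apply: leq_ltn_trans QZ _; rewrite !expnD expn1 -[ltnRHS]mulnA.
  have Ct : C < 2 ^ C by apply: ltn_expl.
  have tt : t.+1 <= 2 ^ t.+1 by apply/ltnW/ltn_expl.
  have abt : a * b * t.+1 <= 2 ^ (3 * t.+1).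
    have -> : 3 * t.+1 = t.+1 + t.+1 + t.+1 by lia.
    by rewrite !expnD; apply: leq_mul => //; apply: leq_mul; lia.
  apply: (@leq_ltn_trans (C * (2 * 2 ^ (3 * t.+1)))).
    by apply: leq_mul => //; apply: leq_mul.
  by rewrite ltn_pmul2r // muln_gt0 expn_gt0.
move: l1 l2 l3; move: (trunc_log Q N) (trunc_log 2 Q) => u v; nia.
Qed.

Definition ell_const (C : nat) : nat := 32 * (C + 7).

Lemma code_length_concat_leq C N a b Q : 0 < N -> 0 < a <= N -> 0 < b <= N ->
  0 < C -> 1 < Q -> Q <= C * (2 * (a * b * (trunc_log 2 N).+1)) ->
  2 * (a * b) * (trunc_log Q N).+1 * (16 * (a * b) * (trunc_log 2 Q).+1)
    <= ell_const C * (a * b) * (a * b * (trunc_log 2 N).+1).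
Proof.
move=> N0 aN bN C0 Q1 QZ; have := digits_product N0 aN bN C0 Q1 QZ.
rewrite /ell_const; move: (trunc_log _ _).+1 (trunc_log _ Q).+1 (trunc_log 2 N).+1 =>
  u v w.
move: (a * b) => m h.
have -> : 2 * m * u * (16 * m * v) = 32 * (m * m) * (u * v) by lia.
have -> : 32 * (C + 7) * m * (m * w) = 32 * (m * m) * ((C + 7) * w) by lia.
by rewrite leq_mul2l h orbT.
Qed.

(** The bound in [c] gives the first claim through [c <= L] and the second through the minimality of
    [c]. In the third, the factor [m] of [m * L] is absorbed into one more power of [A * m]. *)
Lemma code_params_ell C N a b Q q n1 n2 : 0 < N -> 0 < a <= N -> 0 < b <= N ->
  0 < C -> code_params C N a b Q q n1 n2 ->
  let m := a * b in let L := (trunc_log 2 N).+1 in let A := ell_const C in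
  [/\ n1 * n2 * q ^ b <= (A * m * L) ^ b.+1,
      forall c, 0 < c -> N <= a ^ c -> n1 * n2 * q ^ b <= (A * m * c) ^ b.+1 &
      n1 * n2 * q ^ b <= (A * m) ^ b.+2 * L].
Proof.
move=> N0 aN bN C0 par m L A.
have a0 : 0 < a by lia. have b0 : 0 < b by lia.
have m0 : 0 < m by rewrite muln_gt0 a0.
have QZ := code_params_modulus N0 a0 b0 C0 par.
have CA : C <= A by rewrite /A /ell_const; lia.
have A8 : 8 <= A by rewrite /A /ell_const; lia.
have Am : m <= A * m by rewrite leq_pmull //; lia.
case: par => c [/andP[c0 cL] cmin _] [Qp par].
have Q1 := prime_gt1 Qp.
suff [h1 h2] : n1 * n2 * q ^ b <= (A * m * c) ^ b.+1 /\ n1 * n2 * q ^ b <= (A * m) ^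
  b.+2 * L.
  have h3 c' : c <= c' -> n1 * n2 * q ^ b <= (A * m * c') ^ b.+1.
    by move=> cc; apply: leq_trans h1 _; rewrite leq_expn2r // leq_mul2l cc orbT.
  split=> //; first exact: h3.
  by move=> c' c0' Nc; apply: h3; apply: cmin.
move: par; rewrite -/m -/L => -[[cmL /andP[_ QC] -> -> ->]|[mLc _ -> -> ->]].
  rewrite muln1 -expnS.
  have QA : Q <= A * m * c by apply: leq_trans QC _;
    rewrite mulnA leq_mul2r leq_mul2r CA !orbT.
  split; first exact: leq_expn2r.
  apply: leq_trans (leq_expn2r b.+1 QA) _.
  rewrite [leqLHS]expnMn [(A * m) ^ b.+2]expnSr -[leqRHS]mulnA leq_mul2l; apply/orP;
    right.
  by apply: leq_trans cmL _; rewrite leq_mul2r Am orbT.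
have qb : (8 * m) ^ b <= (A * m) ^ b by rewrite leq_expn2r // leq_mul2r A8 orbT.
have nn := code_length_concat_leq N0 aN bN C0 Q1 QZ; rewrite -/m -/L -/A in nn.
have e := leq_mul nn qb.
have e1 : A * m * (m * L) * (A * m) ^ b = (A * m) ^ b.+1 * (m * L)
  by rewrite expnS mulnAC.
rewrite e1 in e; split; apply: leq_trans e _.
  by rewrite [leqRHS]expnMn leq_mul2l (ltnW mLc) orbT.
rewrite [(A * m) ^ b.+2]expnSr -[leqRHS]mulnA leq_mul2l; apply/orP; right.
by rewrite leq_mul2r Am orbT.
Qed.

(** Charges preprocessing to the output. For the bare code [Q * Q] is at most the number of rows;
    for the concatenated one [Q] is [O(m * L)], and the rows number at least [2 m * n2 * (8 m)]. *)
Lemma code_params_square C N a b Q q n1 n2 : 0 < N -> 0 < a -> 0 < b -> 0 < C ->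
  code_params C N a b Q q n1 n2 ->
  let m := a * b in let L := (trunc_log 2 N).+1 in
  m * m <= n1 * n2 * q ^ b /\
  n2 * (Q * Q) <= 4 * (C * L) ^ 2 * (n1 * n2 * q ^ b).
Proof.
move=> N0 a0 b0 C0 par m L.
have QZ := code_params_modulus N0 a0 b0 C0 par; rewrite -/m -/L in QZ.
have [Q1 q1 /andP[n10 nQ] /andP[n20 _] qZ] := code_params_range N0 a0 b0 C0 par.
have m0 : 0 < m by rewrite muln_gt0 a0.
have CL : 0 < (C * L) ^ 2 by rewrite expn_gt0 muln_gt0 C0.
have qb : q <= q ^ b by rewrite -{1}(expn1 q) leq_pexp2l //; lia.
case: par => c [/andP[c0 cL] _ _] [Qp par].
move: par; rewrite -/m -/L => -[[_ /andP[XQ _] qE nE1 nE2]|[_ /andP[XQ _] qE nE1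
  nE2]].
  have mQ : m <= Q by apply: leq_trans (ltnW XQ); rewrite leq_pmulr.
  have QQ : Q * Q <= n1 * n2 * q ^ b.
    by rewrite nE1 nE2 muln1; apply: leq_mul => //; rewrite -qE.
  split; first by apply: leq_trans QQ; apply: leq_mul.
  rewrite {1}nE2 mul1n; apply: leq_trans QQ _; rewrite leq_pmull //; lia.
have kk : 2 * m <= n1 by rewrite nE1 leq_pmulr.
have l1 : 2 * m * n2 * (8 * m) <= n1 * n2 * q ^ b.
  by apply: leq_mul; [rewrite leq_mul2r kk orbT|rewrite -qE].
split; first by apply: leq_trans l1; nia.
apply: leq_trans (leq_mul (leqnn _) l1).
have -> : 4 * (C * L) ^ 2 * (2 * m * n2 * (8 * m)) =
    16 * (n2 * ((C * (2 * (m * L))) * (C * (2 * (m * L))))) by rewrite expnS expn1;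
      lia.
apply: leq_trans (_ : n2 * (C * (2 * (m * L)) * (C * (2 * (m * L)))) <= _).
  by rewrite leq_mul2l leq_mul ?orbT.
by rewrite leq_pmull.
Qed.

(** * The whole program *)

Definition hm_program : cmd := Seq choose_params (Seq build_code output_rows).

Definition time_const (C : nat) : nat := 1000 * (200 * C ^ 2).

Lemma matrix_listingE N l q (h : 'I_l -> 'I_N -> 'I_q) (f : nat -> nat -> nat) :
  (forall i x, h i x = f i x :> nat) ->
  matrix_listing h = [seq f i x | i <- iota 0 l, x <- iota 0 N].
Proof.
move=> hf; rewrite /matrix_listing -!val_enum_ord allpairs_mapl.
apply: (congr1 flatten); apply: eq_map => i /=; rewrite -map_comp.
by apply: eq_map => x; rewrite /= hf.
Qed.

Lemma hm_program_spec C W N a0 b0 :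
  (forall n, 0 < n -> exists2 p, prime p & n < p <= C * n) ->
  0 < N -> 0 < b0 <= a0 ->
  let a := minn a0 N in let b := minn b0 N in
  let m := a * b in let L := (trunc_log 2 N).+1 in
  let Z := C * (2 * (m * L)) in
  N * N < W -> 16 * m * (Z * Z) < W -> 2 * ((2 * Z) ^ 4 * Z) < W ->
  exists Q q n1 n2 t s, let ell := n1 * n2 * q ^ b in
  [/\ code_params C N a b Q q n1 n2,
      exec W hm_program (init_state N a0 b0) t s,
      t <= time_const C * N * L ^ 2 * ell &
      exists h : 'I_ell -> 'I_N -> 'I_2,
        HM_family a0 b0 h /\ output s = matrix_listing h].
Proof.
move=> bert N0 ba a b m L Z NW ZW BW.
have C0 : 0 < C by have [p _ /andP[]] := bert 1 isT; lia.
have aN : 0 < a <= N by rewrite /a; lia.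
have bN : 0 < b <= N by rewrite /b; lia.
have [a0' aN'] := andP aN; have [b0' bN'] := andP bN.
have m0 : 0 < m by rewrite muln_gt0 a0'.
have mL0 : 0 < m * L by rewrite muln_gt0 m0.
have Z0 : 0 < Z by rewrite muln_gt0 C0 muln_gt0 mL0.
have [t1 [s1 [e1 le1 [r2 r12 r22 par]]]] :=
  @choose_params_spec W C (init_state N a0 b0) N a0 b0 bert erefl erefl erefl N0 ba
    NW ZW.
have f1 := exec_frame e1.
rewrite -/a -/b -/m -/L -/Z in r2 r12 le1 par.
move: par; set Q := regs s1 7 in r12 *; set q := regs s1 9;
  set n1 := regs s1 10 in r22 *.
set n2 := regs s1 11 in r22 * => par.
have [Q1 q1 /andP[n10 nQ] /andP[n20 nZ] qQ] := code_params_range N0 a0' b0' C0 par.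
have QZ := code_params_modulus N0 a0' b0' C0 par.
rewrite -/m -/L -/Z in QZ nZ.
have QnZ : Q * n2 <= 16 * m * (Z * Z).
  by apply: leq_trans (leq_mul QZ nZ) _; rewrite mulnCA.
have ZZZ : 16 * (Z * Z) <= 16 * m * (Z * Z) by rewrite -mulnA leq_mul2l leq_pmull.
have QQZ : Q * Q <= Z * Z by apply: leq_mul.
have ZZ : Z <= Z * Z by rewrite leq_pmull.
have NN : N <= N * N by rewrite leq_pmull.
have [t2 [s2 [e2 le2 gr]]] : runs W build_code s1 (1000 * (n2.+1 * (Q.+1 * (Q +
  q).+1)))
    (fun s' => forall x i, x < Q -> i < n2 -> greedy q (tab s' n2) x i).
  apply: (@build_code_spec _ _ Q q n2 ((2 * Q) ^ 4 * Q)) => //; try lia.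
  - exact: code_params_weight par.
  - apply: leq_ltn_trans BW; rewrite leq_mul2l /=; apply: leq_mul => //.
    by rewrite leq_expn2r // leq_mul2l QZ orbT.
  - by move=> i; use_frame f1.
have f2 := exec_frame e2; set T := tab s2 n2 in gr.
have kL : (trunc_log Q N).+1 <= L by rewrite ltnS leq_trunc_log_base.
have LN : L <= N by apply: trunc_log_lt.
have [t3 [s3 [e3 le3 out]]] := @output_rows_spec W s2 N b Q q (trunc_log Q N).+1 n1 n2
  ltac:(use_frame f2; use_frame f1; done) ltac:(use_frame f2; exact: r2)
  ltac:(use_frame f2; done) ltac:(use_frame f2; done) ltac:(use_frame f2; done)
  ltac:(use_frame f2; exact: r12) ltac:(use_frame f2; exact: r22)
  ltac:(move=> ?; use_frame f2; use_frame f1; done)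
  ltac:(move=> ?; use_frame f2; use_frame f1; done)
  ltac:(rewrite (frame_out f2) // (frame_out f1) //)
  bN' q1 ltac:(lia) nQ n20 ltac:(lia) Q1 ltac:(lia) ltac:(lia) ltac:(lia).
set ell := n1 * n2 * q ^ b in le3 out.
have ell0 : 0 < ell by rewrite !muln_gt0 n10 n20 expn_gt0; lia.
exists Q, q, n1, n2, (t1 + (t2 + t3)), s3; split=> //.
- exact: ExecSeq e1 (ExecSeq e2 e3).
- have [mm nQQ] := code_params_square N0 a0' b0' C0 par.
  rewrite -/m -/L -/ell in mm nQQ.
  (* Pays for the search for the parameters, quadratic in [Z = 2 C L m]. *)
  have l1 : Z * Z <= 4 * (C * L) ^ 2 * ell.
    have -> : Z * Z = 4 * (C * L) ^ 2 * (m * m) by rewrite /Z expnS expn1; lia.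
    by rewrite leq_mul2l mm orbT.
  have l2 : n2.+1 * (Q.+1 * (Q + q).+1) <= 40 * (n2 * (Q * Q)).
    have -> : 40 * (n2 * (Q * Q)) = (2 * n2) * ((2 * Q) * (10 * Q)) by lia.
    by apply: leq_mul; [lia|apply: leq_mul; lia].
  have l3 : ell.+1 * (500 * (N.+1 * (trunc_log Q N).+2)) <= 4000 * (N * L * ell).
    have -> : 4000 * (N * L * ell) = (2 * ell) * (500 * ((2 * N) * (2 * L))) by lia.
    by apply: leq_mul; [lia|rewrite leq_mul2l /=; apply: leq_mul; lia].
  have CC : 0 < C ^ 2 by rewrite expn_gt0 C0.
  pose X := C ^ 2 * L ^ 2 * ell.
  have X0 : 0 < X by rewrite muln_gt0 ell0 andbT muln_gt0 !expn_gt0 C0.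
  have l4 : L * ell <= X.
    by rewrite /X leq_mul2r -[leqLHS]mul1n leq_mul ?orbT // -{1}(expn1 L) leq_pexp2l.
  have l5 : X <= N * X by rewrite leq_pmull.
  have l6 : N <= N * X by rewrite leq_pmulr.
  have l7 : N * (L * ell) <= N * X by rewrite leq_mul2l l4 orbT.
  have e4 : 4 * (C * L) ^ 2 * ell = 4 * X by rewrite expnMn /X; lia.
  have -> : time_const C * N * L ^ 2 * ell = 200 * (1000 * (N * X)).
    rewrite /time_const /X; lia.
  rewrite e4 in l1 nQQ; rewrite -!mulnA in l3; lia.
pose sym := code_symbol Q (trunc_log Q N).+1 n2 T.
exists (fun i x => inord (code_hash q b sym i x)).
have hE (i : 'I_ell) (x : 'I_N) :
    (inord (code_hash q b sym i x) : 'I_2) = code_hash q b sym i x :> nat.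
  by rewrite inordK //; case: code_hash.
split; last by rewrite out (matrix_listingE (f := code_hash q b sym)).
have HM : HM_family a b (fun (i : 'I_ell) (x : 'I_N) => inord (code_hash q b sym i x)
  : 'I_2).
  apply: (@code_HM_family N a b (n1 * n2) q sym) => //; try lia.
  - move=> x i xN iR; rewrite /sym /code_symbol.
    have [] := gr (rs_eval Q (trunc_log Q N).+1 x (i %/ n2)) (i %% n2) => //.
      by rewrite /rs_eval ltn_mod; lia.
    by rewrite ltn_mod.
  exact: code_params_agree par gr.
move=> A' B' dAB cA cB; apply: HM => //.
  by rewrite leq_min cA; apply: leq_trans (max_card _) _; rewrite card_ord.
by rewrite leq_min cB; apply: leq_trans (max_card _) _; rewrite card_ord.
Qed.

(** * Bounds *)

(** The exponent [5 * C + 26] comes from the weights: [Z] is at most [U ^ (C + 4)], so the last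
    quantity is at most [U ^ (5 * C + 25)]. *)
Lemma hm_words C N a0 b0 : 0 < N ->
  let m := minn a0 N * minn b0 N in
  let Z := C * (2 * (m * (trunc_log 2 N).+1)) in
  let W := word_modulus (5 * C + 26) N a0 b0 in
  [/\ N * N < W, 16 * m * (Z * Z) < W & 2 * ((2 * Z) ^ 4 * Z) < W].
Proof.
move=> N0 m Z W; set t := (trunc_log 2 (maxn N (maxn a0 b0))).+1.
(* All bounds below are products of powers of [U], as [U] is at least 2 and [N]. *)
pose U := 2 ^ t; have U1 : 1 < U by rewrite -{1}(expn0 2) ltn_exp2l.
have WE : W = U ^ (5 * C + 26) by rewrite /W /word_modulus mulnC expnM.
have NU : N <= U.
  apply: ltnW; apply: leq_ltn_trans (trunc_log_ltn _ (isT : 1 < 2)).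
  by rewrite leq_max leqnn.
have LN : (trunc_log 2 N).+1 <= N by apply: trunc_log_lt.
have U2 : 2 <= U ^ 1 by rewrite expn1.
have CU : C <= U ^ C by apply/ltnW/ltn_expl.
have mU : m <= U ^ 2.
  by rewrite expnS expn1; apply: leq_mul; apply: leq_trans NU; rewrite geq_minr.
have LU : (trunc_log 2 N).+1 <= U ^ 1 by rewrite expn1 (leq_trans LN).
have mulU x y i j : x <= U ^ i -> y <= U ^ j -> x * y <= U ^ (i + j).
  by move=> xi yj; rewrite expnD leq_mul.
have ZU : Z <= U ^ (C + (1 + (2 + 1))).
  by apply: (mulU _ _ C _ CU); apply: (mulU _ _ 1 _ U2); exact: (mulU _ _ 2 1 mU LU).
have U16 : 16 <= U ^ 4 by apply: (@leq_expn2r 2 U 4).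
have fin x i : x <= U ^ i -> i < 5 * C + 26 -> x < W.
  by move=> xi ilt; rewrite WE; apply: leq_ltn_trans xi _; rewrite ltn_exp2l.
split.
- apply: (@fin _ (1 + 1)); last by lia.
  by apply: (mulU _ _ 1 1); rewrite expn1.
- apply: (@fin _ (4 + 2 + ((C + (1 + (2 + 1))) + (C + (1 + (2 + 1)))))); last by lia.
  by apply: (mulU _ _ (4 + 2)); [apply: (mulU _ _ 4 2)|apply: mulU].
apply: (@fin _ (1 + ((1 + (C + (1 + (2 + 1)))) * 4 + (C + (1 + (2 + 1))))));
  last by lia.
apply: (mulU _ _ 1 _ U2); apply: (mulU _ _ _ (C + (1 + (2 + 1)))) => //.
by rewrite expnM; apply: leq_expn2r; apply: (mulU _ _ 1 _ U2).
Qed.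

Lemma hm_program_pointwise C :
  (forall n, 0 < n -> exists2 p, prime p & n < p <= C * n) ->
  forall N a b, 0 < N -> 0 < b -> b <= a -> exists l t,
  let L := (trunc_log 2 N).+1 in let A := ell_const C in
  [/\ computes_HM 2 (5 * C + 26) hm_program N a b l t,
      l <= (A * a * b * L) ^ b.+1,
      forall c, 0 < c -> N <= a ^ c -> l <= (A * c * a * b) ^ b.+1,
      l <= (A * a * b) ^ b.+2 * L &
      t <= time_const C * N * L ^ 2 * l].
Proof.
move=> bert N a b N0 b0 ba.
have [W1 W2 W3] := hm_words C a b N0.
have ba' : 0 < b <= a by rewrite b0.
have [Q [q [n1 [n2 [t [s [par ex tl [h [HM out]]]]]]]]] :=
  hm_program_spec bert N0 ba' W1 W2 W3.
clear W1 W2 W3.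
have C0 : 0 < C by have [p _ /andP[]] := bert 1 isT; lia.
set a' := minn a N in par ex tl h HM out *;
  set b' := minn b N in par ex tl h HM out *.
have aN : 0 < a' <= N by rewrite /a'; lia.
have bN : 0 < b' <= N by rewrite /b'; lia.
have [e1 e2 e3] := code_params_ell N0 aN bN C0 par.
have mm : a' * b' <= a * b by apply: leq_mul; rewrite geq_minl.
have A0 : 0 < ell_const C by rewrite muln_gt0 addn_gt0 orbT.
have bb : b' <= b by rewrite geq_minl.
have ab0 : 0 < a * b by rewrite muln_gt0 b0 andbT (leq_trans b0).
have mono u v i j : 0 < v -> u <= v -> i <= j -> u ^ i <= v ^ j.
  by move=> v0 uv ij; apply: leq_trans (leq_expn2r i uv) (leq_pexp2l v0 ij).
exists (n1 * n2 * q ^ b'), t; split=> //.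
- by exists h, s; split.
- apply: leq_trans e1 _; apply: mono => //.
    by rewrite muln_gt0 andbT -mulnA muln_gt0 A0.
  by rewrite leq_mul2r -[leqRHS]mulnA leq_mul2l mm !orbT.
(* If [a] was capped, the capped value is [N] itself, and [N <= N ^ c]. *)
- move=> c c0 Nc; apply: leq_trans (e2 c c0 _) _.
    rewrite /a' /minn; case: (a < N) => //.
    by rewrite -{1}(expn1 N) leq_pexp2l.
  have -> : ell_const C * c * a * b = ell_const C * (a * b) * c by lia.
  apply: mono => //; first by rewrite muln_gt0 c0 muln_gt0 A0 ab0.
  by rewrite leq_mul2r leq_mul2l mm !orbT.
apply: leq_trans e3 _; rewrite leq_mul2r; apply/orP; right.
rewrite -mulnA; apply: mono => //; first by rewrite muln_gt0 A0.
by rewrite leq_mul2l mm orbT.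
Qed.

(* Real logarithms and asymptotics *)
From mathcomp Require Import all_classical all_reals all_analysis.
From mathcomp Require Import ring lra.
Import Order.TTheory GRing.Theory Num.Theory.
Import numFieldNormedType.Exports.
Local Open Scope classical_set_scope.
Local Open Scope ring_scope.

Section Real.
Variable R : realType.

Lemma log2_ge (N : nat) : (1 < N)%N -> (trunc_log 2 N)%:R <= log2 N%:R :> R.
Proof.
move=> N1; have l2 : 0 < ln 2 :> R by rewrite ln_gt0 // ltr1n.
rewrite /log2 ler_pdivlMr // mulr_natl -lnXn ?ltr0n // -natrX ler_ln ?posrE ?ltr0n
  ?expn_gt0 //; last by lia.
by rewrite ler_nat trunc_logP //; lia.
Qed.

Lemma log2_ge1 (N : nat) : (1 < N)%N -> 1 <= log2 N%:R :> R.
Proof.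
move=> N1; apply: le_trans (log2_ge N1).
by rewrite ler1n trunc_log_max // expn1.
Qed.

Lemma trunc_logS_leq (N : nat) : (1 < N)%N ->
  (trunc_log 2 N).+1%:R <= 2 * log2 N%:R :> R.
Proof.
by move=> N1; have := log2_ge N1; have := log2_ge1 N1; rewrite -natr1; lra.
Qed.

Lemma near_ln_gt (x : R) : \forall N \near \oo, x < ln (N%:R : R).
Proof.
near=> N.
have h : expR x < N%:R by near: N; apply: nbhs_infty_gtr.
by rewrite -ltr_expR lnK // posrE (lt_trans (expR_gt0 x)).
Unshelve. all: by end_near.
Qed.

(** From [ln y <= y - 1] at the square root of [x]. *)
Lemma ln_le_sqrt (x : R) : 0 < x -> ln x <= 2 * Num.sqrt x.
Proof.
move=> x0; have s0 : 0 < Num.sqrt x by rewrite sqrtr_gt0.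
rewrite -{1}(sqr_sqrtr (ltW x0)) lnXn // mulr2n.
set y := Num.sqrt x in s0 *.
have h : ln (1 + (y - 1)) <= y - 1 by apply: le_ln1Dx; lra.
by rewrite addrC subrK in h; lra.
Qed.

(* [N `^ polylog_exponent N] dominates [log2 N ^+ 3] since [ln x <= 2 sqrt x]. *)
Definition polylog_exponent (N : nat) : R :=
  6 / Num.sqrt (ln 2) / Num.sqrt (ln N%:R).

Lemma polylog_exponent_cvg : polylog_exponent @ \oo --> (0 : R).
Proof.
have l2 : 0 < Num.sqrt (ln 2) :> R by rewrite sqrtr_gt0 ln_gt0 // ltr1n.
set c : R := 6 / Num.sqrt (ln 2); have c0 : 0 < c by rewrite divr_gt0.
apply/cvgr0Pnorm_lt => e e0; near=> N.
have h : (c / e) ^+ 2 < ln N%:R by near: N; apply: near_ln_gt.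
have ce : 0 < c / e by rewrite divr_gt0.
have h2 : c / e < Num.sqrt (ln N%:R).
  by rewrite -(ger0_norm (ltW ce)) -sqrtr_sqr ltr_sqrt // (lt_trans _ h) // exprn_gt0.
have s0 := lt_trans ce h2.
rewrite /polylog_exponent -/c ger0_norm; last by rewrite divr_ge0 // ltW.
by rewrite ltr_pdivrMr // mulrC -ltr_pdivrMr.
Unshelve. all: by end_near.
Qed.

Lemma log2_cube_leq (N : nat) : (1 < N)%N ->
  log2 N%:R ^+ 3 <= N%:R `^ polylog_exponent N :> R.
Proof.
move=> N1; have l2 : 0 < ln 2 :> R by rewrite ln_gt0 // ltr1n.
have x0 : 0 < ln N%:R :> R by rewrite ln_gt0 // ltr1n.
have g0 : 0 < log2 N%:R :> R by rewrite divr_gt0.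
rewrite /powR ifF; last by rewrite pnatr_eq0; lia.
rewrite -[leLHS]lnK ?posrE ?exprn_gt0 // ler_expR lnXn //.
(* The 6 in [polylog_exponent] is the exponent 3 times the 2 of this inequality. *)
have := ln_le_sqrt g0.
have -> : Num.sqrt (log2 N%:R) = Num.sqrt (ln N%:R) / Num.sqrt (ln 2) :> R.
  by rewrite /log2 sqrtrM ?(ltW x0) // sqrtrV ?(ltW l2).
set u := Num.sqrt (ln N%:R); set v := Num.sqrt (ln 2).
have u0 : 0 < u by rewrite sqrtr_gt0.
have v0 : 0 < v by rewrite sqrtr_gt0.
have -> : polylog_exponent N * ln N%:R = 6 * (u / v).
  rewrite /polylog_exponent -/u -/v -(sqr_sqrtr (ltW x0)) -/u.
  by field; rewrite !gt_eqF.
by rewrite -mulr_natr; lra.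
Qed.

End Real.

Lemma powR_root_leq (R : realType) (c N a : nat) : (0 < c)%N -> (0 < N)%N ->
  N%:R `^ (c%:R^-1) <= a%:R :> R -> (N <= a ^ c)%N.
Proof.
move=> c0 N0 h; rewrite -(ler_nat R) natrX.
have -> : N%:R = (N%:R `^ (c%:R^-1)) ^+ c :> R.
  by rewrite -powR_mulrn ?powR_ge0 // -powRrM mulVf ?pnatr_eq0 -?lt0n // powRr1.
by rewrite lerXn2r ?nnegrE ?powR_ge0.
Qed.

Theorem theorem3p2 (R : realType) :
  exists alpha : nat,
  exists (kappa : nat) (prog : cmd) (ell time : nat -> nat -> nat -> nat),
  [/\ (0 < kappa)%N,
      (* correctness *)
      (forall N a b : nat, (0 < N)%N -> (0 < b)%N -> (b <= a)%N ->
         computes_HM 2 kappa prog N a b (ell N a b) (time N a b)),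
      (* bounds on ell *)
      [/\ (forall c N a b : nat,
             (0 < c)%N -> (0 < N)%N -> (0 < b)%N -> (b <= a)%N ->
             N%:R `^ (c%:R^-1) <= a%:R :> R ->
             (ell N a b <= (alpha * c * a * b) ^ b.+1)%N),
          (forall a b : nat -> nat,
             (forall N, (0 < b N)%N && (b N <= a N)%N) ->
             subpolynomial R a -> Omega_log R b ->
             \forall N \near \oo,
               (ell N (a N) (b N))%:R <=
               (alpha * a N * b N)%:R ^+ (b N).+2 * log2 N%:R :> R),
          (forall N a b : nat,
             (0 < N)%N -> (0 < b)%N -> (b <= a)%N ->
             a%:R <= log2 N%:R :> R ->
             (ell N a b)%:R <= (alpha * a * b)%:R ^+ b.+2 * log2 N%:R :> R)
        & (forall a b : nat -> nat,
             (forall N, (0 < b N)%N && (b N <= a N)%N) ->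
             ~ polynomially_large R a ->
             ~ (subpolynomial R a /\ Omega_log R b) ->
             ~ at_most_log R a ->
             forall N : nat, (1 < N)%N ->
               (ell N (a N) (b N))%:R <=
               ((alpha * a N * b N)%:R * log2 N%:R) ^+ (b N).+1 :> R)]
      (* bounds on the running time *)
    & (forall a b : nat -> nat,
         (forall N, (0 < b N)%N && (b N <= a N)%N) ->
         subpolynomial R a -> Omega_log R b ->
         exists2 e : R ^nat, e @ \oo --> (0 : R) &
           \forall N \near \oo,
             (time N (a N) (b N))%:R <=
             N%:R `^ (1 + e N) * (ell N (a N) (b N))%:R :> R)
      /\
      (exists k : nat, forall a b : nat -> nat,
         (forall N, (0 < b N)%N && (b N <= a N)%N) ->
         ~ (subpolynomial R a /\ Omega_log R b) ->
         \forall N \near \oo,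
           (time N (a N) (b N))%:R <=
           N%:R * log2 N%:R ^+ k * (ell N (a N) (b N))%:R :> R)].
Proof.
have [C C0 bert] := weak_bertrand.
have [ell [time HP]] : exists ell time : nat -> nat -> nat -> nat,
    forall N a b, (0 < N)%N -> (0 < b)%N -> (b <= a)%N ->
    let l := ell N a b in let t := time N a b in
    let L := (trunc_log 2 N).+1 in let A := ell_const C in
    [/\ computes_HM 2 (5 * C + 26) hm_program N a b l t,
      (l <= (A * a * b * L) ^ b.+1)%N,
      forall c, (0 < c)%N -> (N <= a ^ c)%N -> (l <= (A * c * a * b) ^ b.+1)%N,
      (l <= (A * a * b) ^ b.+2 * L)%N &
      (t <= time_const C * N * L ^ 2 * l)%N].
  (* Prepares the choice of [ell] and [time] as functions; inadmissible inputs receive the dummy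
     value [(0, 0)]. *)
  have P (x : nat * nat * nat) : exists y : nat * nat,
      let N := x.1.1 in let a := x.1.2 in let b := x.2 in
      (0 < N)%N -> (0 < b)%N -> (b <= a)%N ->
      let l := y.1 in let t := y.2 in
      let L := (trunc_log 2 N).+1 in let A := ell_const C in
      [/\ computes_HM 2 (5 * C + 26) hm_program N a b l t,
        (l <= (A * a * b * L) ^ b.+1)%N,
        forall c, (0 < c)%N -> (N <= a ^ c)%N -> (l <= (A * c * a * b) ^ b.+1)%N,
        (l <= (A * a * b) ^ b.+2 * L)%N &
        (t <= time_const C * N * L ^ 2 * l)%N].
    case: x => [[N a] b] /=.
    have [/and3P[N0 b0 ba]|no] := boolP [&& (0 < N)%N, (0 < b)%N & (b <= a)%N].
      by have [l [t h]] := hm_program_pointwise bert N0 b0 ba; exists (l, t).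
    by exists (0%N, 0%N) => N0 b0 ba; rewrite N0 b0 ba in no.
  have [f fP] := choice P.
  exists (fun N a b => (f (N, a, b)).1), (fun N a b => (f (N, a, b)).2) => N a b.
  exact: (fP (N, a, b)).
have A0 : (0 < ell_const C)%N by rewrite muln_gt0 addn_gt0 orbT.
set A := ell_const C in A0 HP.
(* The digit count of [N] is at most [2 * log2 N]; this 2 is absorbed by taking [alpha = 2 * A]. *)
have log_pow N a b : (1 < N)%N -> (0 < b)%N -> (b <= a)%N ->
    (ell N a b)%:R <= (2 * A * a * b)%:R ^+ b.+2 * log2 N%:R :> R.
  move=> N1 b0 ba; have [_ _ _ h _] := HP N a b (ltnW N1) b0 ba.
  have lg := trunc_logS_leq R N1; have lg1 := log2_ge1 R N1.
  apply: (@le_trans _ _ (((A * a * b) ^ b.+2)%N%:R * (2 * log2 N%:R))).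
    apply: (@le_trans _ _ ((A * a * b) ^ b.+2 * (trunc_log 2 N).+1)%N%:R).
      by rewrite ler_nat.
    by rewrite natrM ler_wpM2l // ler0n.
  rewrite mulrA ler_wpM2r //; first lra.
  have -> : (2 * A * a * b = 2 * (A * a * b))%N by lia.
  move: (A * a * b)%N => m;
    rewrite natrX natrM exprMn mulrC ler_wpM2r ?exprn_ge0 ?ler0n //.
  by rewrite -natrX ler_nat -{1}(expn1 2) leq_exp2l.
have poly_log N a b : (1 < N)%N -> (0 < b)%N -> (b <= a)%N ->
    (ell N a b)%:R <= ((2 * A * a * b)%:R * log2 N%:R) ^+ b.+1 :> R.
  move=> N1 b0 ba; have [_ h _ _ _] := HP N a b (ltnW N1) b0 ba.
  have lg := trunc_logS_leq R N1; have lg1 := log2_ge1 R N1.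
  apply: (@le_trans _ _ ((A * a * b * (trunc_log 2 N).+1) ^ b.+1)%N%:R).
    by rewrite ler_nat.
  have lg0 : 0 <= log2 N%:R :> R by lra.
  have -> : (2 * A * a * b = A * a * b * 2)%N by lia.
  rewrite natrX; move: (A * a * b)%N => m.
  apply: lerXn2r; rewrite ?nnegrE ?ler0n //.
    by apply: mulr_ge0.
  by rewrite !natrM -mulrA; apply: ler_wpM2l.
have run N a b : (1 < N)%N -> (0 < b)%N -> (b <= a)%N ->
    (time N a b)%:R <= (4 * time_const C)%:R * (N%:R * log2 N%:R ^+ 2 * (ell N a
      b)%:R) :> R.
  move=> N1 b0 ba; have [_ _ _ _ h] := HP N a b (ltnW N1) b0 ba.
  have lg := trunc_logS_leq R N1; have lg1 := log2_ge1 R N1.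
  apply: (@le_trans _ _ (time_const C * N * (trunc_log 2 N).+1 ^ 2 * ell N a b)%N%:R).
    by rewrite ler_nat.
  rewrite (natrM _ (_ * _ * _)) (natrM _ (_ * _)) (natrM _ (time_const C)) natrX.
  rewrite (natrM _ 4).
  set K := (time_const C)%:R : R; set T := (trunc_log 2 N).+1%:R : R.
  have h2 : T ^+ 2 <= 4 * log2 N%:R ^+ 2.
    have -> : 4 * log2 N%:R ^+ 2 = (2 * log2 N%:R) ^+ 2 :> R by ring.
    by rewrite lerXn2r ?nnegrE ?ler0n //; lra.
  have -> : 4 * K * (N%:R * log2 N%:R ^+ 2 * (ell N a b)%:R) =
      K * N%:R * (4 * log2 N%:R ^+ 2) * (ell N a b)%:R by ring.
  by rewrite ler_wpM2r ?ler0n // ler_wpM2l // mulr_ge0 ?ler0n.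
(* A third factor [log2 N] eventually exceeds the constant of the running time. *)
have run3 a b : (forall N, (0 < b N)%N && (b N <= a N)%N) ->
    \forall N \near \oo, [/\ (1 < N)%N & (time N (a N) (b N))%:R <=
      N%:R * log2 N%:R ^+ 3 * (ell N (a N) (b N))%:R :> R].
  move=> ab; near=> N.
  have N1 : (1 < N)%N by near: N; apply: nbhs_infty_gt.
  have big : (4 * time_const C)%:R * ln 2 < ln N%:R :> R by near: N;
    apply: near_ln_gt.
  split=> //; have /andP[b0 ba] := ab N.
  apply: le_trans (run N _ _ N1 b0 ba) _.
  have lg1 := log2_ge1 R N1.
  have K : (4 * time_const C)%:R <= log2 N%:R :> R.
    by rewrite /log2 ler_pdivlMr ?ltW // ln_gt0 // ltr1n.
  have -> : N%:R * log2 N%:R ^+ 3 * (ell N (a N) (b N))%:R =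
      log2 N%:R * (N%:R * log2 N%:R ^+ 2 * (ell N (a N) (b N))%:R) :> R by ring.
  apply: ler_wpM2r => //; apply: mulr_ge0 => //; apply: mulr_ge0 => //.
  by apply: exprn_ge0; lra.
exists (2 * A)%N, (5 * C + 26)%N, hm_program, ell, time; split.
- by rewrite addn_gt0 orbT.
- by move=> N a b N0 b0 ba; have [] := HP N a b N0 b0 ba.
- split.
  + move=> c N a b c0 N0 b0 ba h; have [_ _ h2 _ _] := HP N a b N0 b0 ba.
    apply: leq_trans (h2 c c0 (powR_root_leq c0 N0 h)) _; apply: leq_expn2r.
    by rewrite !leq_mul2r leq_pmull // !orbT.
  + move=> a b ab _ _; near=> N; have /andP[b0 ba] := ab N; apply: log_pow => //.
    by near: N; apply: nbhs_infty_gt.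
  + move=> N a b N0 b0 ba aN; apply: log_pow => //.
    (* [N = 1] is excluded, as its logarithm 0 is below [a]. *)
    rewrite ltn_neqAle N0 andbT; apply: contraTneq aN => <-.
    by rewrite /log2 ln1 mul0r lern0; lia.
  + move=> a b ab _ _ _ N N1; have /andP[b0 ba] := ab N; exact: poly_log.
- split.
  + move=> a b ab _ _; exists (polylog_exponent R); first exact: polylog_exponent_cvg.
    apply: filterS (run3 a b ab) => N [N1 h]; apply: le_trans h _.
    have N0 : N%:R != 0 :> R by rewrite pnatr_eq0; lia.
    rewrite ler_wpM2r ?ler0n // powRD; last by rewrite N0 implybT.
    by rewrite powRr1 ?ler0n // ler_wpM2l ?ler0n // log2_cube_leq.
  + exists 3 => a b ab _; by apply: filterS (run3 a b ab) => N [].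
Unshelve. all: by end_near.
Qed.
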